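(* Let $X=\ell_p$ with $p>1$. If $1<p<2$, then the topologies WOT and SOT are similar on $\mathcal{P}_1(X)$, and the topologies SOT$_*$ and SOT$^*$ are similar on $\mathcal{P}_1(X)$. If $p>2$, then the topologies SOT and SOT$^*$ are similar on $\mathcal{P}_1(X)$, and the topologies WOT and SOT$_*$ are similar on $\mathcal{P}_1(X)$.
   Context: $\ell_p=\ell_p(\mathbb{Z}_+)$ is the complex sequence space, $\mathbb{Z}_+=\{0,1,2,\dots\}$, with canonical basis $(e_n)_{n\ge 0}$. A vector $x=\sum_n x_n e_n$ is positive ($x\ge 0$) if $x_n\ge 0$ for all $n$; a bounded operator $T$ on $X$ is positive if $Tx\ge 0$ whenever $x\ge 0$. $\mathcal{P}_1(X)$ denotes the set of all positive operators $T$ on $X$ with $\|T\|\le 1$ (positive contractions). The operator topologies (restricted to $\mathcal{P}_1(X)$, on which each is Polish) are: WOT (weak operator topology): $T_i\to T$ iff $\langle y^*,T_ix\rangle\to\langle y^*,Tx\rangle$ for all $x\in X$, $y^*\in X^*$; SOT (strong operator topology): $T_i\to T$ iff $\|T_ix-Tx\|\to 0$ for all $x\in X$; SOT$_*$ (dual strong operator topology): $T_i\to T$ iff $\|T_i^*y^*-T^*y^*\|\to 0$ for all $y^*\in X^*$; SOT$^*$ (strong* operator topology): $T_i\to T$ iff both $T_i\to T$ in SOT and $T_i\to T$ in SOT$_*$. Two topologies on a set $\mathbf{Y}$ are called similar if they have the same dense subsets of $\mathbf{Y}$. *)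

(* Defs.v *)
From HB Require Import structures.
From mathcomp Require Import all_boot all_order all_algebra.
From mathcomp Require Import all_classical all_reals all_analysis.
From mathcomp Require Import complex.

Set Implicit Arguments.
Unset Strict Implicit.
Unset Printing Implicit Defensive.

Import Order.TTheory GRing.Theory Num.Theory.
Import numFieldNormedType.Exports.
Import Normc.

Local Open Scope classical_set_scope.
Local Open Scope complex_scope.
Local Open Scope ring_scope.

Section similar.
Variable Y : choiceType.

(* [Topological Y] is the type of topologies on [Y]; carrying them explicitly
   lets several topologies live on the same set. *)
Definition similar (t1 t2 : Topological Y) :=
  forall D : set Y,
    @dense (Topological.Pack t1) D <-> @dense (Topological.Pack t2) D.

End similar.

Section similar_on.
Variable Y : choiceType.
Implicit Types (t : Topological Y) (A : set Y).

Definition restrict_top t A : Topological (set_type A) :=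
  Topological.on (set_type (A : set (Topological.Pack t))).

Lemma restrict_top_openP t A (D : set (set_type A)) :
  @open (Topological.Pack (restrict_top t A)) D <->
  exists2 U, @open (Topological.Pack t) U & set_val @^-1` U = D.
Proof. by []. Qed.

Definition similar_on A t1 t2 :=
  similar (restrict_top t1 A) (restrict_top t2 A).

End similar_on.

Section family_top.
Variables (Y : choiceType) (I : Type) (Z : I -> topologicalType).
Variable f : forall i, Y -> Z i.

(* coarsest topology on [Y] making every [f i] continuous *)
Definition family_top : Topological Y :=
  Topological.on (sup_topology
    (fun i => Topological.on (initial_topology (f i)))).

Lemma family_top_cvgP (F : set_system Y) (y : Y) : Filter F ->
  F --> (y : Topological.Pack family_top) <-> forall i, f i @ F --> f i y.
Proof.
move=> FF.
have H := @cvg_sup Y I (fun i => Topological.on (initial_topology (f i))) F y FF.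
split=> [/H Fy i | Fy].
  exact: (cvg_trans (cvg_app (f i) (Fy i)) (@initial_continuous _ _ (f i) y)).
apply/H => i A; rewrite (@nbhsE (initial_topology (f i))).
move=> -[_ [[B oB <-] By] BA].
by apply: (filterS BA); apply: (Fy i); exact: open_nbhs_nbhs.
Qed.

End family_top.

Section bounded_operators.
Variables (R : realType) (V W : normedModType R[i]).

Definition bounded_linear : {pred V -> W} :=
  [pred f | `[< linear f /\ exists M : R[i], forall x, `|f x| <= M * `|x| >]].

Record bop := Bop {
  bop_fun :> V -> W;
  bop_subproof : bop_fun \in bounded_linear
}.

HB.instance Definition _ := [isSub for bop_fun].
HB.instance Definition _ := [Choice of bop by <:].

Lemma bopP (T : bop) : linear T /\ exists M : R[i], forall x, `|T x| <= M * `|x|.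
Proof. by apply/asboolP; exact: bop_subproof. Qed.

HB.instance Definition _ (T : bop) :=
  GRing.isLinear.Build R[i] V W _ (bop_fun T) (bopP T).1.

Lemma bounded_linear_submod_closed : submod_closed bounded_linear.
Proof.
split.
  apply/asboolP; split=> [a x y|]; first by rewrite /= scaler0 addr0.
  by exists 0 => x; rewrite normr0 mul0r.
move=> a f g /asboolP[lf [M fM]] /asboolP[lg [N gN]]; apply/asboolP; split.
  move=> b x y; change (a *: f (b *: x + y) + g (b *: x + y) =
    b *: (a *: f x + g x) + (a *: f y + g y)).
  rewrite lf lg !scalerDr !scalerA.
  by rewrite (mulrC a b) addrACA.
exists (`|a| * M + N) => x; change (`|a *: f x + g x| <= (`|a| * M + N) * `|x|).
rewrite (le_trans (ler_normD _ _))// mulrDl lerD//.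
by rewrite normrZ -mulrA ler_wpM2l.
Qed.

HB.instance Definition _ :=
  GRing.isSubmodClosed.Build _ _ bounded_linear bounded_linear_submod_closed.
HB.instance Definition _ := [SubChoice_isSubLmodule of bop by <:].

Lemma bopD (S T : bop) x : (S + T) x = S x + T x. Proof. by []. Qed.
Lemma bopZ a (T : bop) x : (a *: T) x = a *: T x. Proof. by []. Qed.

(* Norms over [R[i]] take their values in [R[i]]; they are real, and [complex.Re]
   recovers the value in [R]. *)
Definition opnorm (T : bop) : R :=
  sup [set complex.Re `|T x| | x in [set x : V | `|x| <= 1]].

Let normRe (U : normedModType R[i]) (x : U) : (complex.Re `|x|)%:C = `|x|.
Proof. by rewrite RRe_real. Qed.

Let opnorm_has_sup (T : bop) :
  has_sup [set complex.Re `|T x| | x in [set x : V | `|x| <= 1]].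
Proof.
split; first by exists (complex.Re `|T 0|), 0 => //=; rewrite normr0 ler01.
have [_ [M TM]] := bopP T; exists (complex.Re `|M|) => _ [x /= x1 <-].
rewrite -lecR !normRe (le_trans (TM x))//.
rewrite (le_trans (real_ler_norm _))//.
  by rewrite ger0_real// (le_trans _ (TM x)).
by rewrite normrM normr_id ler_piMr.
Qed.

Lemma opnorm_ub (T : bop) x : `|x| <= 1 -> `|T x| <= (opnorm T)%:C.
Proof.
move=> x1; rewrite -normRe lecR; apply: (sup_upper_bound (opnorm_has_sup T)).
by exists x.
Qed.

Lemma opnorm_le_ub (T : bop) (M : R) :
  (forall x, `|x| <= 1 -> `|T x| <= M%:C) -> opnorm T <= M.
Proof.
move=> TM; apply: (ge_sup (opnorm_has_sup T).1) => _ [x x1 <-].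
by rewrite -lecR normRe; exact: TM.
Qed.

Lemma opnorm_ge0 (T : bop) : 0 <= opnorm T.
Proof.
rewrite -lecR; apply: le_trans (opnorm_ub T (x := 0) _) => //.
by rewrite normr0 ler01.
Qed.

Lemma opnormP (T : bop) x : `|T x| <= (opnorm T)%:C * `|x|.
Proof.
have [->|x0] := eqVneq x 0; first by rewrite linear0 !normr0 mulr0.
have nx : 0 < `|x| by rewrite normr_gt0.
have := @opnorm_ub T (`|x|^-1 *: x).
rewrite linearZ /= !normrZ normfV normr_id mulVf ?gt_eqF// => /(_ (lexx _)).
by rewrite ler_pdivrMl// mulrC.
Qed.

Let ler_opnormD (S T : bop) :
  (opnorm (S + T))%:C <= (opnorm S)%:C + (opnorm T)%:C.
Proof.
rewrite -rmorphD lecR /=; apply: opnorm_le_ub => x x1.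
by rewrite bopD rmorphD /= (le_trans (ler_normD _ _))// lerD// opnorm_ub.
Qed.

Let opnormZle a (T : bop) : (opnorm (a *: T))%:C <= `|a| * (opnorm T)%:C.
Proof.
rewrite -(normRe (a : R[i]^o)) -rmorphM lecR /=; apply: opnorm_le_ub => x x1.
by rewrite bopZ normrZ rmorphM /= (normRe (a : R[i]^o)) ler_wpM2l// opnorm_ub.
Qed.

Let opnormZ a (T : bop) : (opnorm (a *: T))%:C = `|a| * (opnorm T)%:C.
Proof.
apply/eqP; rewrite eq_le opnormZle /=.
have [->|a0] := eqVneq a 0.
  by rewrite normr0 mul0r lecR opnorm_ge0.
rewrite -ler_pdivlMl ?normr_gt0//.
by have := opnormZle a^-1 (a *: T); rewrite scalerA mulVf// scale1r normfV.
Qed.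

Let opnorm_eq0 (T : bop) : (opnorm T)%:C = 0 :> R[i] -> T = 0.
Proof.
move=> T0; apply/val_inj/funext => x.
by have := opnormP T x; rewrite T0 mul0r normr_le0 => /eqP.
Qed.

HB.instance Definition _ :=
  Lmodule_isNormed.Build R[i] bop ler_opnormD opnormZ opnorm_eq0.

Lemma bop_normE (T : bop) : `|T| = (opnorm T)%:C. Proof. by []. Qed.

End bounded_operators.

Definition dual (R : realType) (V : normedModType R[i]) := bop V R[i]^o.
HB.instance Definition _ (R : realType) (V : normedModType R[i]) :=
  NormedModule.on (dual V).

Section adjoint.
Variables (R : realType) (V W : normedModType R[i]) (T : bop V W).

Lemma adjoint_subproof (f : dual W) :
  (fun x => f (T x)) \in @bounded_linear R V R[i]^o.
Proof.
apply/asboolP; split=> [a x y|]; first by rewrite !linearP.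
exists ((opnorm f)%:C * (opnorm T)%:C) => x.
rewrite (le_trans (opnormP f _))// -mulrA ler_wpM2l ?opnormP//.
by rewrite lecR opnorm_ge0.
Qed.

Definition adjoint (f : dual W) : dual V := Bop (adjoint_subproof f).

End adjoint.

Section operator_topologies.
Variables (R : realType) (X : normedModType R[i]).
Local Notation L := (bop X X).

Definition WOT : Topological L :=
  family_top (fun (p : dual X * X) (T : L) => p.1 (T p.2) : R[i]^o).

Definition SOT : Topological L := family_top (fun (x : X) (T : L) => T x).

(* The codomain [dual X] carries the operator norm. *)
Definition SOTd : Topological L :=
  family_top (fun (y : dual X) (T : L) => adjoint T y).

Definition SOTs : Topological L :=
  Topological.on (sup_topology (fun b : bool => if b then SOT else SOTd)).

Lemma WOT_cvgP (F : set_system L) (T : L) : Filter F ->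
  F --> (T : Topological.Pack WOT) <->
  forall (x : X) (y : dual X), (fun S : L => y (S x) : R[i]^o) @ F --> y (T x).
Proof.
move=> FF; rewrite family_top_cvgP.
by split=> [FT x y|FT [y x]]; [exact: (FT (y, x))|exact: FT].
Qed.

Lemma SOT_cvgP (F : set_system L) (T : L) : Filter F ->
  F --> (T : Topological.Pack SOT) <->
  forall x : X, (fun S : L => S x) @ F --> T x.
Proof. by move=> FF; exact: family_top_cvgP. Qed.

Lemma SOTd_cvgP (F : set_system L) (T : L) : Filter F ->
  F --> (T : Topological.Pack SOTd) <->
  forall y : dual X, (fun S : L => adjoint S y) @ F --> adjoint T y.
Proof. by move=> FF; exact: family_top_cvgP. Qed.

Lemma SOTs_cvgP (F : set_system L) (T : L) : Filter F ->
  F --> (T : Topological.Pack SOTs) <->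
  F --> (T : Topological.Pack SOT) /\ F --> (T : Topological.Pack SOTd).
Proof.
move=> FF.
have H := @cvg_sup L bool (fun b : bool => if b then SOT else SOTd) F T FF.
split=> [/H FT|[FT FTd]]; first by split; [exact: (FT true)|exact: (FT false)].
by apply/H => -[].
Qed.

End operator_topologies.

Section ellp.
Variables (R : realType) (p : R) (p1 : 1 <= p).
Implicit Types x y : nat -> R[i].

Definition ellp_Lnorm x : \bar R :=
  'N[counting]_(p%:E)[EFin \o (@normc R \o x)]%E.

Let p0 : 0 < p. Proof. exact: lt_le_trans p1. Qed.

Lemma ellp_LnormE x :
  ellp_Lnorm x = ((\sum_(n <oo) (normc (x n) `^ p)%:E) `^ p^-1)%E.
Proof.
rewrite /ellp_Lnorm Lnorm_counting//; congr (_ `^ _)%E.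
apply: eq_eseriesr => n _ /=.
by rewrite ger0_norm//; case: (x n) => a b; rewrite sqrtr_ge0.
Qed.

Let normc_ge0 (z : R[i]) : 0 <= normc z.
Proof. by case: z => a b; rewrite sqrtr_ge0. Qed.

Lemma ellp_Lnorm_ge0 x : (0 <= ellp_Lnorm x)%E.
Proof. exact: Lnorm_ge0. Qed.

Lemma ellp_LnormD x y : (ellp_Lnorm (x + y)%R <= ellp_Lnorm x + ellp_Lnorm y)%E.
Proof.
have mf (f : nat -> R) : measurable_fun [set: nat] f by [].
apply: (le_trans _ (@minkowski_EFin _ _ _ counting _ _ _ (mf _) (mf _) p1)).
rewrite /ellp_Lnorm !Lnorm_counting//.
apply: gt0_ler_poweR; rewrite ?invr_ge0 ?(ltW p0)//.
- by rewrite in_itv /= leey andbT nneseries_ge0// => n _ _; exact: poweR_ge0.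
- by rewrite in_itv /= leey andbT nneseries_ge0// => n _ _; exact: poweR_ge0.
apply: lee_nneseries => [n _ _|n _]; first exact: poweR_ge0.
apply: gt0_ler_poweR; rewrite ?(ltW p0)//= ?in_itv /= ?leey ?andbT ?lee_fin//.
by rewrite !ger0_norm ?addr_ge0// le_normcD.
Qed.

Lemma ellp_LnormZ (a : R[i]) x :
  ellp_Lnorm (a *: x) = ((normc a)%:E * ellp_Lnorm x)%E.
Proof.
rewrite !ellp_LnormE.
rewrite (eq_eseriesr
  (g := fun n => ((normc a `^ p)%:E * (normc (x n) `^ p)%:E)%E)).
  rewrite nneseriesZl; last by move=> n _; rewrite lee_fin powR_ge0.
  rewrite poweRM ?lee_fin ?powR_ge0 ?nneseries_ge0//; last first.
    by move=> n _ _; rewrite lee_fin powR_ge0.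
  by rewrite poweR_EFin -powRrM mulfV ?gt_eqF// powRr1.
by move=> n _; rewrite -EFinM -powRM// -normcM.
Qed.

Lemma ellp_Lnorm_eq0 x : ellp_Lnorm x = 0%E -> x = 0.
Proof.
rewrite ellp_LnormE => /poweR_eq0_eq0.
have sge0 n : (0 <= (normc (x n) `^ p)%:E)%E by rewrite lee_fin powR_ge0.
move=> /(_ (nneseries_ge0 (fun n _ _ => sge0 n))) s0; apply/funext => n.
apply: eq0_normc; apply/eqP.
have /eqP : (normc (x n) `^ p)%:E = 0%E.
  apply/eqP; rewrite eq_le sge0 andbT -s0.
  apply: le_trans (nneseries_lim_ge n.+1 (fun k _ _ => sge0 k)).
  by rewrite big_nat_recr//= leeDr// sume_ge0.
by rewrite eqe powR_eq0 => /andP[].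
Qed.

(* [p1] is an argument because the closure properties below need it *)
Definition in_ellp of 1 <= p : {pred nat -> R[i]} :=
  [pred x | (ellp_Lnorm x < +oo)%E].

Lemma ellp_submod_closed : submod_closed (in_ellp p1).
Proof.
split=> [|a x y]; rewrite !inE.
  rewrite -(scale0r (0 : nat -> R[i])) ellp_LnormZ normc0 mul0e.
  by rewrite ltry.
move=> Nx Ny; rewrite (le_lt_trans (ellp_LnormD _ _))// lte_add_pinfty//.
by rewrite ellp_LnormZ lte_mul_pinfty// lee_fin.
Qed.

HB.instance Definition _ :=
  GRing.isSubmodClosed.Build _ _ (in_ellp p1) ellp_submod_closed.

Record ellp := Ellp {
  ellp_val :> nat -> R[i];
  ellp_subproof : ellp_val \in in_ellp p1
}.

HB.instance Definition _ := [isSub for ellp_val].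
HB.instance Definition _ := [Choice of ellp by <:].
HB.instance Definition _ := [SubChoice_isSubLmodule of ellp by <:].

Definition ellp_norm (x : ellp) : R := fine (ellp_Lnorm x).

Let ellp_normK (x : ellp) : (ellp_norm x)%:E = ellp_Lnorm x.
Proof.
by rewrite fineK// ge0_fin_numE ?ellp_Lnorm_ge0//; exact: (ellp_subproof x).
Qed.

Let ler_ellp_normD (x y : ellp) :
  (ellp_norm (x + y))%:C <= (ellp_norm x)%:C + (ellp_norm y)%:C.
Proof.
by rewrite -rmorphD lecR -lee_fin EFinD !ellp_normK ellp_LnormD.
Qed.

Let ellp_normZ (a : R[i]) (x : ellp) :
  (ellp_norm (a *: x))%:C = `|a| * (ellp_norm x)%:C.
Proof.
suff -> : ellp_norm (a *: x) = normc a * ellp_norm x by rewrite rmorphM.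
by apply: EFin_inj; rewrite EFinM !ellp_normK ellp_LnormZ.
Qed.

Let ellp_norm_eq0 (x : ellp) : (ellp_norm x)%:C = 0 :> R[i] -> x = 0.
Proof.
move=> [] x0; apply/val_inj/ellp_Lnorm_eq0.
by rewrite -[LHS]ellp_normK x0.
Qed.

HB.instance Definition _ :=
  Lmodule_isNormed.Build R[i] ellp ler_ellp_normD ellp_normZ ellp_norm_eq0.

Lemma ellp_normE (x : ellp) :
  `|x| = (fine (\sum_(n <oo) (normc (x n) `^ p)%:E)%E `^ p^-1)%:C.
Proof. by rewrite -fine_poweR -ellp_LnormE. Qed.

(* in [R[i]], [0 <= z] means that [z] is real and nonnegative *)
Definition ellp_ge0 (x : ellp) := forall n, 0 <= x n.

Definition positive_op (T : bop ellp ellp) :=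
  forall x : ellp, ellp_ge0 x -> ellp_ge0 (T x).

Definition positive_contractions : set (bop ellp ellp) :=
  [set T | positive_op T /\ `|T| <= 1].

End ellp.

Arguments positive_contractions {R p} p1.

(* Main.v *)
Require Import Defs.
From mathcomp Require Import all_boot all_order all_algebra.
From mathcomp Require Import all_classical all_reals all_analysis.
From mathcomp Require Import complex.
From mathcomp Require Import ring lra.

Set Implicit Arguments.
Unset Strict Implicit.
Unset Printing Implicit Defensive.

Import Order.TTheory GRing.Theory Num.Theory.
Import numFieldNormedType.Exports.

Local Open Scope classical_set_scope.
Local Open Scope ring_scope.

(** All four topologies lie between WOT and the strong* topology. Two of them,
    one finer than the other, are therefore similar on the set P1 of positive
    contractions as soon as the points of P1 at which every strong*
    neighbourhood contains the trace on P1 of a WOT neighbourhood are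
    strong*-dense in P1: a nonempty open set of the finer topology contains
    such a point, hence a nonempty open set of the coarser one
    ([similar_on_of_continuity_points]).

    A positive contraction [T] is such a point when it has a norming vector,
    that is some [u] such that [u] and [T u] are strictly positive in every
    coordinate and [|T u| = |u|] ([norming_continuity_point]). Let [S] in P1 be
    WOT-close to [T]. Columns: finitely many coordinates of [S u] are close to
    those of [T u], and [|S u| <= |u| = |T u|], so the tail of [S u] is small in
    norm; by positivity [S e_j <= u_j^-1 S u] coordinatewise, so [S e_j] has a
    small tail too and is close to [T e_j] in norm. Rows: let [x >= 0] have norm
    at most 1 and be supported far away. By convexity of [t^p], the number
    [|S (u + s x)|^p] exceeds [|S u|^p] by at least [p s (S u)_k^(p-1) (S x)_k],
    whereas [|u + s x|^p] exceeds [|u|^p] by [O(s^p)] only. As [p > 1], a small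
    [s] shows that [(S x)_k] is small uniformly in [x]. For contractions, norm
    convergence of each column and of each row is strong* convergence
    ([cvg_SOTs_of_rows_columns]).

    Operators with a norming vector are strong*-dense in P1 ([norming_dense]).
    Given [T] in P1, mix its upper left [m * m] block with a little of the
    constant matrix [1 / m]; this is a contractive matrix [A] with positive
    entries. A maximiser [u] of [|A u|] on the unit sphere is positive and
    satisfies [A^t (A u)^(p-1) <= u^(p-1)] ([exists_subinvariant_vector]).
    Border [A] by one row [c >= 0] and a corner [d], chosen so that, with [z] the
    new coordinate of the image of [(u, 1)],
    [A^t (A u)^(p-1) + c z^(p-1) = u^(p-1)] and [d z^(p-1) = 1]. By Schur's test
    the bordered matrix is a contraction, and it attains its norm at [(u, 1)].
    Replacing [u] by a small multiple makes [c] small, so that completing by the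
    identity on the remaining coordinates gives an operator whose rows and
    columns are close to those of [T]. *)

(** * Inequalities for powers, and Schur's test *)

Section power.
Variables (R : realType) (p : R).
Hypothesis p_gt1 : 1 < p.
Implicit Types s t : R.

Let p_gt0 : 0 < p. Proof. exact: lt_trans p_gt1. Qed.
Let pB1_gt0 : 0 < p - 1. Proof. by rewrite subr_gt0. Qed.

Lemma ler_powRl s t r : 0 <= r -> 0 <= s -> s <= t -> s `^ r <= t `^ r.
Proof.
move=> r0 s0 st; apply: ge0_ler_powR => //; rewrite nnegrE//.
exact: le_trans st.
Qed.

Lemma powRK_gt0 s r : r != 0 -> 0 <= s -> (s `^ r^-1) `^ r = s.
Proof. by move=> r0 s0; rewrite -powRrM mulVf// powRr1. Qed.

(** The graph of the convex function [t^p] lies above its tangents; this is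
    Young's inequality for [t] and [s^(p-1)]. *)
Lemma powR_tangent s t : 0 <= s -> 0 <= t ->
  s `^ p + p * s `^ (p - 1) * (t - s) <= t `^ p.
Proof.
move=> s0 t0.
have pB1 : p - 1 != 0 by rewrite gt_eqF.
have p0 : p != 0 by rewrite gt_eqF.
have q0 : 0 < p / (p - 1) by rewrite divr_gt0.
have pq : p^-1 + (p / (p - 1))^-1 = 1 by field; apply/andP.
have := conjugate_powR t0 (powR_ge0 s (p - 1)) p_gt0 q0 pq.
rewrite -powRrM mulrCA divff// mulr1 -(mulr_powRB1 s0 p_gt0).
set b := s `^ (p - 1); set a := t `^ p => h.
have {h} : p * (t * b) <= a + (p - 1) * (s * b).
  rewrite -(ler_pM2l p_gt0) in h; apply: (le_trans h).
  by rewrite le_eqVlt; apply/orP; left; apply/eqP; field; apply/andP.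
by move=> h; nra.
Qed.

Lemma powR_jensen (I : finType) (w t : I -> R) :
  (forall i, 0 <= w i) -> \sum_i w i = 1 -> (forall i, 0 <= t i) ->
  (\sum_i w i * t i) `^ p <= \sum_i w i * t i `^ p.
Proof.
move=> w0 w1 t0; set m := \sum_i w i * t i.
have m0 : 0 <= m by apply: sumr_ge0 => i _; rewrite mulr_ge0.
have -> : m `^ p =
    \sum_i w i * (m `^ p + p * m `^ (p - 1) * (t i - m)).
  under eq_bigr do rewrite mulrDr mulrCA mulrBr.
  rewrite big_split /= -mulr_suml w1 mul1r -mulr_sumr sumrB.
  by rewrite -mulr_suml w1 mul1r subrr mulr0 addr0.
by apply: ler_sum => i _; rewrite ler_wpM2l// powR_tangent.
Qed.

(** Schur's test: with [v = a u], each row of [a] turns into the weights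
    [a k j * u j / v k] of a barycentre of the ratios [x j / u j]. Jensen's
    inequality bounds its [p]-th power, and summing over the rows brings in the
    transpose of [a] applied to [v^(p-1)]. *)
Lemma schur_test (I J : finType) (a : J -> I -> R) (u x : I -> R) :
  (forall k j, 0 <= a k j) -> (forall j, 0 < u j) ->
  (forall k, 0 < \sum_j a k j * u j) ->
  (forall j, \sum_k a k j * (\sum_i a k i * u i) `^ (p - 1) <= u j `^ (p - 1)) ->
  (forall j, 0 <= x j) ->
  \sum_k (\sum_j a k j * x j) `^ p <= \sum_j x j `^ p.
Proof.
move=> a0 u0 au0 avu x0.
pose v k := \sum_j a k j * u j; have v0 k : 0 < v k := au0 k.
pose w k j := a k j * u j / v k.
have w0 k j : 0 <= w k j by rewrite divr_ge0// ?mulr_ge0// ltW.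
have step k : (\sum_j a k j * x j) `^ p <=
    \sum_j (x j / u j) `^ p * (u j * (a k j * v k `^ (p - 1))).
  have -> : \sum_j a k j * x j = v k * \sum_j w k j * (x j / u j).
    rewrite mulr_sumr; apply: eq_bigr => j _; rewrite /w; field.
    by rewrite !gt_eqF.
  have ? : 0 <= \sum_j w k j * (x j / u j).
    by apply: sumr_ge0 => j _; rewrite mulr_ge0// divr_ge0// ltW.
  rewrite powRM// ?(ltW (v0 k))//.
  apply: (@le_trans _ _ (v k `^ p * \sum_j w k j * (x j / u j) `^ p)).
    rewrite ler_wpM2l ?powR_ge0//; apply: powR_jensen => // [|j].
      by rewrite -mulr_suml divff// gt_eqF.
    by rewrite divr_ge0// ltW// u0.
  rewrite mulr_sumr; apply: ler_sum => j _.
  rewrite -(mulr_powRB1 (ltW (v0 k)) p_gt0) /w.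
  rewrite le_eqVlt; apply/orP; left; apply/eqP; field.
  by rewrite gt_eqF.
apply: (le_trans (ler_sum _ (fun k _ => step k))).
rewrite exchange_big /=; apply: ler_sum => j _.
rewrite -mulr_sumr -mulr_sumr.
apply: (@le_trans _ _ ((x j / u j) `^ p * (u j * u j `^ (p - 1)))).
  by rewrite ler_wpM2l ?powR_ge0// ler_wpM2l// ltW.
rewrite mulr_powRB1 ?(ltW (u0 j))// -powRM ?divr_ge0// ?(ltW (u0 j))//.
by rewrite divfK// gt_eqF.
Qed.

Lemma ler_dist_powR s t : 0 <= s -> 0 <= t ->
  `|t `^ p - s `^ p| <= p * (s + t) `^ (p - 1) * `|t - s|.
Proof.
move=> s0 t0; wlog st : s t s0 t0 / s <= t.
  move=> H; have [|/ltW] := leP s t; first exact: H.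
  by move=> ts; rewrite distrC (distrC t) (addrC s) H.
have pst : s `^ p <= t `^ p by rewrite ler_powRl// ltW.
rewrite !ger0_norm ?subr_ge0//.
have := powR_tangent t0 s0.
have : p * t `^ (p - 1) * (t - s) <= p * (s + t) `^ (p - 1) * (t - s).
  rewrite ler_wpM2r ?subr_ge0// ler_wpM2l ?(ltW p_gt0)//.
  by rewrite ler_powRl ?(ltW pB1_gt0)// lerDr.
lra.
Qed.

(** The absolute value is there because [t `^ p] is [1] at every negative [t],
    hence discontinuous at [0]. *)
Lemma norm_powR_continuous : continuous (fun t : R => `|t| `^ p).
Proof.
move=> s; apply/cvgrPdist_lt => e e0.
pose K := p * (`|s| + (`|s| + 1)) `^ (p - 1) + 1.
have K0 : 0 < K.
  by rewrite ltr_wpDl// mulr_ge0 ?powR_ge0 ?(ltW p_gt0).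
near=> t.
have st1 : `|s - t| < 1.
  by near: t; apply: (@cvgr_dist_lt _ _ _ _ _ id) => //; exact: cvg_id.
have steK : `|s - t| < e / K.
  near: t; apply: (@cvgr_dist_lt _ _ _ _ _ id); first exact: cvg_id.
  by rewrite divr_gt0.
have ts : `|t| <= `|s| + 1.
  have -> : t = s - (s - t) by rewrite subKr.
  by rewrite (le_trans (ler_normB _ _))// lerD2l ltW.
apply: le_lt_trans (ler_dist_powR (normr_ge0 t) (normr_ge0 s)) _.
apply: (@le_lt_trans _ _ (K * `|s - t|)).
  apply: ler_pM => //; rewrite ?mulr_ge0 ?powR_ge0// ?(ltW p_gt0)//.
    rewrite /K ler_wpDr// ler_wpM2l ?(ltW p_gt0)//.
    by rewrite ler_powRl ?(ltW pB1_gt0) ?addr_ge0// addrC lerD2l.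
  exact: ler_dist_dist.
by rewrite mulrC -ltr_pdivlMr.
Unshelve. all: by end_near. Qed.

End power.

(** * Similarity of topologies and points of continuity *)

Section similarity.
Variable Y : choiceType.
Implicit Types (t : Topological Y) (A : set Y).

Definition finer t1 t2 := forall S (V : set Y),
  @nbhs _ (Topological.Pack t1) S V -> @nbhs _ (Topological.Pack t2) S V.

(** Let [O] be a nonempty [t2]-open set and [S] a point of continuity in it. Then
    [O] contains, within [A], a [tw]-neighbourhood of [S], hence a nonempty
    [t1]-open set, which meets every [t1]-dense set. *)
Lemma similar_on_of_continuity_points A tw t1 t2 ts :
  finer tw t1 -> finer t1 t2 -> finer t2 ts ->
  (forall T (U : set Y), A T -> @nbhs _ (Topological.Pack ts) T U ->
    exists S, [/\ A S, U S & forall V : set Y,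
      @nbhs _ (Topological.Pack ts) S V ->
      @nbhs _ (Topological.Pack tw) S [set S' | A S' -> V S']]) ->
  similar_on A t1 t2.
Proof.
move=> w1 t12 t2s key D; split=> dD O.
  move=> [[T AT] OT] /restrict_top_openP[U oU UO].
  have AT' : A T by exact: set_mem AT.
  have UT : @nbhs _ (Topological.Pack ts) T U.
    apply: t2s; apply: open_nbhs_nbhs; split => //.
    by move: OT; rewrite -UO.
  have [S [AS US cS]] := key _ _ AT' UT.
  have : @nbhs _ (Topological.Pack t1) S [set S' | A S' -> U S'].
    apply: w1; apply: cS; apply: t2s; apply: open_nbhs_nbhs; split => //.
  rewrite (@nbhsE (Topological.Pack t1)) => -[W [oW WS] WU].
  have [||[S' AS'] [OS' DS']] := dD (set_val @^-1` W).
  - by exists (exist _ S (mem_set AS)).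
  - by apply: (restrict_top_openP t1 _).2; exists W.
  exists (exist _ S' AS'); split => //.
  by rewrite -UO; apply: WU => //; exact: set_mem AS'.
move=> O0 /restrict_top_openP[U oU UO]; apply: dD O0 _.
apply: (restrict_top_openP t2 _).2; exists U => //.
rewrite (@openE (Topological.Pack t2)) => S US.
by apply: t12; apply: open_nbhs_nbhs.
Qed.

End similarity.

Section operator_topology_comparison.
Variables (R : realType) (X : normedModType R[i]).

Lemma dual_continuous (y : dual X) : continuous (y : X -> R[i]^o).
Proof.
move=> x; apply/cvgrPdist_lt => e e0.
have n0 : (0 : R[i]) < (opnorm y)%:C%C + 1.
  by rewrite ltr_wpDl// lecR opnorm_ge0.
have : \forall z \near x, `|x - z| < e / ((opnorm y)%:C%C + 1).
  by apply: cvgr_dist_lt; [exact: cvg_id|rewrite divr_gt0].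
apply: filterS => z; rewrite ltr_pdivlMr// => xz.
have -> : y x - y z = y (x - z) by rewrite linearB.
apply: le_lt_trans (opnormP _ _) _; apply: le_lt_trans xz.
by rewrite mulrC ler_wpM2l// lerDl.
Qed.

Lemma WOT_le_SOT : finer (WOT X) (SOT X).
Proof.
move=> S V.
suff : (@nbhs _ (Topological.Pack (SOT X)) S) -->
    (S : Topological.Pack (WOT X)).
  by apply.
apply/WOT_cvgP => x y.
apply: (@continuous_cvg _ _ _ _ _ (fun T : bop X X => T x) _ _
  (@dual_continuous y (S x))).
exact: (SOT_cvgP S (nbhs_filter (S : Topological.Pack (SOT X)))).1.
Qed.

Lemma WOT_le_SOTd : finer (WOT X) (SOTd X).
Proof.
move=> S V.
suff : (@nbhs _ (Topological.Pack (SOTd X)) S) -->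
    (S : Topological.Pack (WOT X)).
  by apply.
apply/WOT_cvgP => x y.
have /(_ (fun U SU => SU) y)/cvgrPdist_lt h :=
  (SOTd_cvgP S (nbhs_filter (S : Topological.Pack (SOTd X)))).1.
apply/cvgrPdist_lt => e e0.
have n0 : 0 < `|x| + 1 by rewrite ltr_wpDl.
have : \forall T \near @nbhs _ (Topological.Pack (SOTd X)) S,
    `|adjoint S y - adjoint T y| < e / (`|x| + 1).
  by apply: h; rewrite divr_gt0.
apply: filterS => T; rewrite ltr_pdivlMr// => xz.
rewrite [ltLHS](_ : _ = `|(adjoint S y - adjoint T y) x|)//.
apply: le_lt_trans (opnormP _ _) _; rewrite -bop_normE.
by apply: le_lt_trans xz; rewrite ler_wpM2l// lerDl.
Qed.

Lemma SOT_le_SOTs : finer (SOT X) (SOTs X).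
Proof.
move=> S V.
suff : (@nbhs _ (Topological.Pack (SOTs X)) S) -->
    (S : Topological.Pack (SOT X)).
  by apply.
have cS := (SOTs_cvgP S (nbhs_filter (S : Topological.Pack (SOTs X)))).1.
exact: (cS (fun U SU => SU)).1.
Qed.

Lemma SOTd_le_SOTs : finer (SOTd X) (SOTs X).
Proof.
move=> S V.
suff : (@nbhs _ (Topological.Pack (SOTs X)) S) -->
    (S : Topological.Pack (SOTd X)).
  by apply.
have cS := (SOTs_cvgP S (nbhs_filter (S : Topological.Pack (SOTs X)))).1.
exact: (cS (fun U SU => SU)).2.
Qed.

End operator_topology_comparison.

(** * Extremal vectors of matrices with positive entries *)

Lemma cvg_sum_fct (K : numFieldType) (V : normedModType K) (T I : Type)
    (F : set_system T) (r : seq I) (P : pred I) (f : I -> T -> V) (a : I -> V) :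
  Filter F -> (forall i, P i -> f i @ F --> a i) ->
  (fun t => \sum_(i <- r | P i) f i t) @ F --> \sum_(i <- r | P i) a i.
Proof.
move=> FF fa.
apply: (@cvg_big V I +%R 0 P _ T F r f a FF fa).
exact: pseudometric_normed_Zmodule.add_continuous.
Qed.

Section strictly_positive_matrix.
Variables (R : realType) (p : R).
Hypothesis p_gt1 : 1 < p.

Let p_gt0 : 0 < p. Proof. exact: lt_trans p_gt1. Qed.
Let pB1_gt0 : 0 < p - 1. Proof. by rewrite subr_gt0. Qed.

(** A form of right-continuity of [t^(p-1)], read off its inverse function. *)
Lemma ltr_powR_shift (l u : R) : 0 <= u -> u `^ (p - 1) < l ->
  exists2 s, 0 < s & (u + s) `^ (p - 1) < l.
Proof.
move=> u0 ul.
have l0 : 0 < l := le_lt_trans (powR_ge0 _ _) ul.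
have pB1 : p - 1 != 0 by rewrite gt_eqF.
pose w := l `^ (p - 1)^-1.
have wl : w `^ (p - 1) = l by rewrite powRK_gt0// ltW.
have w0 : 0 <= w := powR_ge0 _ _.
have uw : u < w.
  rewrite ltNge; apply/negP => wu.
  by move: ul; rewrite ltNge -wl ler_powRl// ltW.
exists ((w - u) / 2); first by rewrite divr_gt0// subr_gt0.
rewrite -wl; apply: gt0_ltr_powR => //; rewrite ?nnegrE//; last by lra.
by apply: addr_ge0 => //; rewrite divr_ge0// subr_ge0 ltW.
Qed.

(** Compactness of the part of the unit sphere where all coordinates are
    nonnegative, then homogeneity. *)
Lemma exists_norm_maximizer (n : nat) (A : 'I_n.+1 -> 'I_n.+1 -> R) :
  (forall k j, 0 <= A k j) ->
  exists2 u : 'I_n.+1 -> R, (forall j, 0 <= u j) /\ \sum_j u j `^ p = 1 &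
    forall x : 'I_n.+1 -> R, (forall j, 0 <= x j) ->
      \sum_k (\sum_j A k j * x j) `^ p <=
      (\sum_k (\sum_j A k j * u j) `^ p) * \sum_j x j `^ p.
Proof.
move=> A0.
pose F (x : 'rV[R]_n.+1) := \sum_k `|\sum_j A k j * x ord0 j| `^ p.
pose G (x : 'rV[R]_n.+1) := \sum_j `|x ord0 j| `^ p.
pose D := [set x : 'rV[R]_n.+1 | (forall j, 0 <= x ord0 j) /\ G x = 1].
have cF : continuous F.
  move=> x; rewrite /F; apply: cvg_sum_fct => [|k _]; first exact: nbhs_filter.
  apply: (@continuous_comp _ _ _ (fun x : 'rV[R]_n.+1 => \sum_j A k j * x ord0 j)
    (fun t : R => `|t| `^ p)); last exact: norm_powR_continuous.
  apply: cvg_sum_fct => [|j _]; first exact: nbhs_filter.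
  apply: (@continuousM _ _ (cst (A k j)) (fun x : 'rV[R]_n.+1 => x ord0 j)).
    exact: cst_continuous.
  exact: coord_continuous.
have cG : continuous G.
  move=> x; rewrite /G; apply: cvg_sum_fct => [|j _]; first exact: nbhs_filter.
  apply: (@continuous_comp _ _ _ (fun x : 'rV[R]_n.+1 => x ord0 j)
    (fun t : R => `|t| `^ p)); last exact: norm_powR_continuous.
  exact: coord_continuous.
have D0 : D !=set0.
  exists (\row_j (j == ord0)%:R); split=> [j|]; first by rewrite mxE ler0n.
  rewrite /G (bigD1 ord0)//= mxE eqxx normr1 powR1 big1 ?addr0// => j j0.
  by rewrite mxE (negbTE j0) normr0 powR0// gt_eqF.
have cD : compact D.
  apply: bounded_closed_compact.
    exists 1; split=> // M M1 x [x0 Gx]; apply: le_trans (ltW M1).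
    rewrite [X in X <= _]mx_normrE; apply: bigmax_le => // -[i j] _ /=.
    rewrite (ord1 i) leNgt; apply/negP => x1.
    suff : 1 < G x by rewrite Gx ltxx.
    apply: (lt_le_trans x1); rewrite /G (bigD1 j)//=.
    apply: (@le_trans _ _ (`|x ord0 j| `^ p)).
      by rewrite le1r_powR// ltW.
    by rewrite lerDl; apply: sumr_ge0 => *; exact: powR_ge0.
  rewrite (_ : D = \bigcap_(j in setT) ((fun x : 'rV[R]_n.+1 => x ord0 j) @^-1`
      [set t | 0 <= t]) `&` G @^-1` [set t | t = 1]); last first.
    rewrite /D; apply/seteqP; split=> x /= [h1 h2]; split => // j; last exact: h1.
    by move=> _; exact: h1.
  apply: closedI.
    apply: closed_bigI => j _; apply: closed_comp; last exact: closed_ge.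
    by move=> x _; exact: coord_continuous.
  by apply: closed_comp; [move=> x _; exact: cG|exact: closed_eq].
have [u uD umax] := EVT_max_rV D0 cD (continuous_subspaceT cF).
rewrite inE in uD; case: uD => u0 Gu.
have GE (x : 'rV[R]_n.+1) : (forall j, 0 <= x ord0 j) -> G x = \sum_j x ord0 j `^ p.
  by move=> x0; apply: eq_bigr => j _; rewrite ger0_norm.
have FE (x : 'rV[R]_n.+1) : (forall j, 0 <= x ord0 j) ->
    F x = \sum_k (\sum_j A k j * x ord0 j) `^ p.
  move=> x0; apply: eq_bigr => j _; rewrite ger0_norm//.
  by apply: sumr_ge0 => i _; rewrite mulr_ge0.
exists (u ord0); first by rewrite -GE.
move=> x x0; rewrite -FE//.
pose N := \sum_j x j `^ p.
have N0 : 0 <= N by apply: sumr_ge0 => *; exact: powR_ge0.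
have p0 : p != 0 by rewrite gt_eqF.
move: (N0); rewrite le_eqVlt => /orP[/eqP N00|Ngt].
  rewrite -/N -N00 mulr0 big1// => k _.
  rewrite big1 ?powR0// => j _.
  have : x j `^ p = 0.
    apply/eqP; rewrite eq_le powR_ge0 andbT N00 /N (bigD1 j)//= lerDl.
    by apply: sumr_ge0 => *; exact: powR_ge0.
  by move/powR_eq0_eq0 ->; rewrite mulr0.
pose c := N `^ p^-1.
have c0 : 0 < c by exact: powR_gt0.
have cN : c `^ p = N by rewrite powRK_gt0.
pose y : 'rV[R]_n.+1 := \row_j (c^-1 * x j).
have y0 j : 0 <= y ord0 j by rewrite mxE mulr_ge0// invr_ge0 ltW.
have xE j : x j = c * y ord0 j by rewrite mxE mulVKf// gt_eqF.
have NE : N = N * G y.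
  rewrite GE// mulr_sumr; apply: eq_bigr => j _.
  by rewrite -cN -powRM ?(ltW c0)// -xE.
have Gy : G y = 1.
  by apply: (mulfI (lt0r_neq0 Ngt)); rewrite mulr1 -NE.
have yD : y \in D by rewrite inE.
have := umax _ yD; rewrite -(ler_pM2l Ngt) mulrC.
rewrite [F u * _]mulrC; apply: le_trans; rewrite FE// mulr_suml.
apply: ler_sum => k _; rewrite mulrC -cN -powRM ?(ltW c0)//; last first.
  by apply: sumr_ge0 => i _; rewrite mulr_ge0.
rewrite le_eqVlt mulr_sumr; apply/orP; left; apply/eqP; congr (_ `^ _).
by apply: eq_bigr => j _; rewrite xE mulrCA.
Qed.

(** The Euler-Lagrange inequality at a maximiser [u] of [|A x|^p / |x|^p]: moving
    [u] by [s] in direction [j] raises [|A u|^p] by at least [p s g j], where [g]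
    is the transpose of [A] applied to [(A u)^(p-1)], and raises [|u|^p] by at
    most [p s (u j + s)^(p-1)]. As the maximum is at most [1], letting [s] tend to
    [0] gives [g j <= u j ^(p-1)], and [g j > 0] forces [u j > 0]. *)
Lemma exists_subinvariant_vector (n : nat) (A : 'I_n.+1 -> 'I_n.+1 -> R) :
  (forall k j, 0 < A k j) ->
  (forall x : 'I_n.+1 -> R, (forall j, 0 <= x j) ->
    \sum_k (\sum_j A k j * x j) `^ p <= \sum_j x j `^ p) ->
  exists2 u : 'I_n.+1 -> R, (forall j, 0 < u j) &
    forall j, \sum_k A k j * (\sum_i A k i * u i) `^ (p - 1) <= u j `^ (p - 1).
Proof.
move=> A0 A1.
have A0' k j : 0 <= A k j by exact: ltW.
have [u [u0 u1] umax] := exists_norm_maximizer A0'.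
pose v k := \sum_i A k i * u i.
pose L := \sum_k v k `^ p.
pose g j := \sum_k A k j * v k `^ (p - 1).
have [i0 i0u] : exists i, 0 < u i.
  apply: contrapT => /forallNP h.
  move/eqP: u1; rewrite big1 ?(eq_sym 0) ?oner_eq0// => j _.
  have -> : u j = 0 by apply/eqP; rewrite eq_le u0 andbT leNgt; apply/negP/h.
  by rewrite powR0// gt_eqF.
have v0 k : 0 < v k.
  rewrite /v (bigD1 i0)//= ltr_pwDl ?mulr_gt0//.
  by apply: sumr_ge0 => j _; rewrite mulr_ge0.
have L1 : L <= 1 by rewrite -u1; exact: A1.
have L0 : 0 <= L by apply: sumr_ge0 => *; exact: powR_ge0.
have g0 j : 0 < g j.
  rewrite /g (bigD1 ord0)//= ltr_pwDl ?mulr_gt0 ?powR_gt0//.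
  by apply: sumr_ge0 => k _; rewrite mulr_ge0// powR_ge0.
have gu j : g j <= u j `^ (p - 1).
  rewrite leNgt; apply/negP => /(ltr_powR_shift (u0 j))[s s0 us].
  pose x i := u i + s * (i == j)%:R.
  have x0 i : 0 <= x i by rewrite addr_ge0// mulr_ge0 ?ler0n// ltW.
  have AxE k : \sum_i A k i * x i = v k + s * A k j.
    rewrite /v (bigD1 j)//= [in RHS](bigD1 j)//= /x eqxx mulr1.
    under eq_bigr => i ij do rewrite (negbTE ij) mulr0 addr0.
    by ring.
  have low : L + p * s * g j <= \sum_k (\sum_i A k i * x i) `^ p.
    rewrite /L /g mulr_sumr -big_split; apply: ler_sum => k _ /=.
    rewrite AxE; have := powR_tangent p_gt1 (ltW (v0 k)) (_ : 0 <= v k + s * A k j).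
    rewrite addrAC subrr add0r => h.
    apply: le_trans (h _); last by rewrite addr_ge0 ?mulr_ge0 ?ltW.
    by rewrite le_eqVlt; apply/orP; left; apply/eqP; ring.
  have up : \sum_i x i `^ p <= 1 + p * s * (u j + s) `^ (p - 1).
    rewrite (bigD1 j)//= -[X in _ <= X + _]u1 [X in _ <= X + _](bigD1 j)//= addrAC.
    rewrite [X in _ + X <= _](eq_bigr (fun i => u i `^ p)); last first.
      by move=> i ij; rewrite /x (negbTE ij) mulr0 addr0.
    rewrite lerD2r /x eqxx mulr1.
    have := powR_tangent p_gt1 (_ : 0 <= u j + s) (u0 j).
    rewrite addr_ge0 ?(ltW s0)// => /(_ isT).
    lra.
  have := umax _ x0; rewrite -/(v _).
  have : L * (\sum_i x i `^ p) <= L + p * s * (u j + s) `^ (p - 1).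
    apply: (@le_trans _ _ (L * (1 + p * s * (u j + s) `^ (p - 1)))).
      by rewrite ler_wpM2l.
    rewrite mulrDr mulr1 lerD2l ler_piMl//.
    by rewrite !mulr_ge0 ?powR_ge0// ltW.
  move=> h1 h2; have := le_trans low (le_trans h2 h1).
  rewrite lerD2l ler_pM2l ?mulr_gt0//.
  by rewrite leNgt us.
exists u => // j.
rewrite lt_neqAle u0 andbT eq_sym; apply/negP => /eqP uj.
have := lt_le_trans (g0 j) (gu j).
by rewrite uj powR0 ?ltxx// gt_eqF.
Qed.

End strictly_positive_matrix.

(** * Coordinates, truncations and unit vectors in the sequence space *)

Section ellp_coordinates.
Variables (R : realType) (p : R) (p1 : 1 <= p).
Local Notation X := (ellp p1).
Local Notation modc := (@Normc.normc R).
Local Notation N := (@ellp_norm R p p1).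
Implicit Types (x y : X) (n k : nat).

Let p_gt0 : 0 < p. Proof. exact: lt_le_trans p1. Qed.
Let p_neq0 : p != 0. Proof. by rewrite gt_eqF. Qed.

Lemma normc_ge0 (z : R[i]) : 0 <= modc z.
Proof. by case: z => a b; rewrite sqrtr_ge0. Qed.

Lemma normcR (t : R) : 0 <= t -> modc t%:C%C = t.
Proof. by move=> t0; rewrite /= expr0n addr0 sqrtr_sqr ger0_norm. Qed.

Lemma ge0_normcK (z : R[i]) : 0 <= z -> (modc z)%:C%C = z.
Proof.
case: z => a b; rewrite lecE /= => /andP[/eqP -> a0].
by rewrite expr0n addr0 sqrtr_sqr ger0_norm.
Qed.

Lemma normc_sum (I : Type) (r : seq I) (P : pred I) (F : I -> R[i]) :
  modc (\sum_(i <- r | P i) F i) <= \sum_(i <- r | P i) modc (F i).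
Proof.
elim/big_ind2 : _ => [|a b a' b' ab ab'|//]; first by rewrite Normc.normc0.
by apply: le_trans (le_normcD _ _) _; exact: lerD.
Qed.

Definition psum (x : nat -> R[i]) n := \sum_(k < n) modc (x k) `^ p.

Lemma psum_mono (x : nat -> R[i]) n m : (n <= m)%N -> psum x n <= psum x m.
Proof.
move=> /subnKC <-; rewrite /psum big_split_ord /= lerDl.
by apply: sumr_ge0 => *; exact: powR_ge0.
Qed.

Let psumE (x : nat -> R[i]) n :
  (\sum_(0 <= k < n) (modc (x k) `^ p)%:E)%E = (psum x n)%:E.
Proof. by rewrite big_mkord sumEFin. Qed.

Let series_le (x : nat -> R[i]) (K : R) : (forall n, psum x n <= K) ->
  (\sum_(n <oo) (modc (x n) `^ p)%:E <= K%:E)%E.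
Proof.
move=> xK; apply: lime_le.
  by apply: is_cvg_nneseries => n _ _; rewrite lee_fin powR_ge0.
by apply: nearW => n; rewrite psumE lee_fin.
Qed.

Lemma mem_ellp (x : nat -> R[i]) (K : R) :
  (forall n, psum x n <= K) -> x \in in_ellp p1.
Proof.
move=> /series_le xK; rewrite inE (ellp_LnormE p1); apply: poweR_lty.
exact: le_lt_trans xK (ltry _).
Qed.

Lemma ellp_norm_ge0 x : 0 <= N x.
Proof. by rewrite fine_ge0// ellp_Lnorm_ge0. Qed.

Lemma ellp_norm_powR x :
  (N x `^ p)%:E = (\sum_(n <oo) (modc (x n) `^ p)%:E)%E.
Proof.
have s0 : (0 <= \sum_(n <oo) (modc (x n) `^ p)%:E)%E.
  by apply: nneseries_ge0 => n _ _; rewrite lee_fin powR_ge0.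
have := ellp_subproof x; rewrite inE (ellp_LnormE p1).
rewrite /ellp_norm (ellp_LnormE p1).
case: (\sum_(n <oo) _)%E s0 => [r| |//].
  by rewrite lee_fin => r0 _; rewrite /= powRK_gt0.
by rewrite /= invr_eq0 (negbTE p_neq0).
Qed.

Lemma psum_le_norm x n : psum x n <= N x `^ p.
Proof.
rewrite -lee_fin ellp_norm_powR -psumE; apply: nneseries_lim_ge => k _ _.
by rewrite lee_fin powR_ge0.
Qed.

(** With [psum_le_norm], this says that [N x `^ p] is the least upper bound of the
    partial sums, which is all that is used about the series below. *)
Lemma norm_le_psum x (K : R) : (forall n, psum x n <= K) -> N x `^ p <= K.
Proof. by move=> /series_le; rewrite -ellp_norm_powR lee_fin. Qed.

Lemma ler_powRlP (s t : R) : 0 <= s -> 0 <= t -> s `^ p <= t `^ p -> s <= t.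
Proof.
move=> s0 t0; apply: contraTT; rewrite -!ltNge => ts.
by apply: gt0_ltr_powR => //; rewrite nnegrE.
Qed.

Lemma ellp_norm_mono x y :
  (forall k, modc (x k) <= modc (y k)) -> N x <= N y.
Proof.
move=> xy; apply: ler_powRlP; rewrite ?ellp_norm_ge0//.
apply: norm_le_psum => n; apply: le_trans (psum_le_norm y n).
by apply: ler_sum => k _; rewrite ler_powRl// ?normc_ge0// ltW.
Qed.

Lemma mem_ellp_le (x : nat -> R[i]) y :
  (forall k, modc (x k) <= modc (y k)) -> x \in in_ellp p1.
Proof.
move=> xy; apply: (@mem_ellp _ (N y `^ p)) => n.
apply: le_trans (psum_le_norm y n).
by apply: ler_sum => k _; rewrite ler_powRl// ?normc_ge0// ltW.
Qed.

Lemma coord_le_norm x k : modc (x k) <= N x.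
Proof.
apply: ler_powRlP; rewrite ?ellp_norm_ge0 ?normc_ge0//.
apply: le_trans (psum_le_norm x k.+1); rewrite /psum big_ord_recr /= lerDr.
by apply: sumr_ge0 => *; exact: powR_ge0.
Qed.

Lemma normC_ellp x : `|x| = (N x)%:C%C. Proof. by []. Qed.

Lemma ellp_norm_le1 x : (`|x| <= 1) = (N x <= 1).
Proof. by rewrite normC_ellp -(rmorph1 (real_complex R)) lecR. Qed.

Lemma ellp_normD x y : N (x + y) <= N x + N y.
Proof. by have := ler_normD x y; rewrite !normC_ellp -rmorphD lecR. Qed.

Lemma ellp_normB x y : N (x - y) <= N x + N y.
Proof. by have := ler_normB x y; rewrite !normC_ellp -rmorphD lecR. Qed.

Lemma ellp_normZ (a : R[i]) x : N (a *: x) = modc a * N x.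
Proof.
apply: (@complexI R); rewrite rmorphM -!normC_ellp normrZ.
by rewrite normc_def; case: a.
Qed.

Lemma ellp_norm0 : N 0 = 0.
Proof. by apply: (@complexI R); rewrite -normC_ellp normr0. Qed.

Lemma ellp_normN x : N (- x) = N x.
Proof. by apply: (@complexI R); rewrite -!normC_ellp normrN. Qed.

Lemma ellp_norm_sum (I : Type) (r : seq I) (P : pred I) (f : I -> X) :
  N (\sum_(i <- r | P i) f i) <= \sum_(i <- r | P i) N (f i).
Proof.
rewrite -lecR rmorph_sum -normC_ellp; apply: le_trans (ler_norm_sum _ _ _) _.
by apply: ler_sum => i _; rewrite normC_ellp.
Qed.

Lemma ellpP x y : (forall k, x k = y k) -> x = y.
Proof. by move=> xy; apply/val_inj/funext. Qed.

Lemma ellpDE x y k : (x + y) k = x k + y k. Proof. by []. Qed.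
Lemma ellpBE x y k : (x - y) k = x k - y k. Proof. by []. Qed.
Lemma ellpZE (a : R[i]) x k : (a *: x) k = a * x k. Proof. by []. Qed.
Lemma ellp_sumE (I : Type) (r : seq I) (P : pred I) (f : I -> X) k :
  (\sum_(i <- r | P i) f i) k = \sum_(i <- r | P i) f i k.
Proof. exact: (big_morph (fun x : X => x k) (fun x y => ellpDE x y k)). Qed.

Definition head_seq n (x : nat -> R[i]) k := if (k < n)%N then x k else 0.
Definition tail_seq n (x : nat -> R[i]) k := if (k < n)%N then 0 else x k.

Lemma head_subproof n x : head_seq n x \in in_ellp p1.
Proof.
apply: (@mem_ellp_le _ x) => k; rewrite /head_seq; case: ifP => // _.
by rewrite Normc.normc0 normc_ge0.
Qed.

Lemma tail_subproof n x : tail_seq n x \in in_ellp p1.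
Proof.
apply: (@mem_ellp_le _ x) => k; rewrite /tail_seq; case: ifP => // _.
by rewrite Normc.normc0 normc_ge0.
Qed.

Definition ellp_head n x : X := Ellp (head_subproof n x).
Definition ellp_tail n x : X := Ellp (tail_subproof n x).

Lemma headE n x k : ellp_head n x k = if (k < n)%N then x k else 0.
Proof. by []. Qed.
Lemma tail_coordE n x k : ellp_tail n x k = if (k < n)%N then 0 else x k.
Proof. by []. Qed.

Lemma head_add_tail n x : ellp_head n x + ellp_tail n x = x.
Proof.
apply: ellpP => k; rewrite ellpDE /= /head_seq /tail_seq.
by case: ifP; rewrite ?addr0 ?add0r.
Qed.

Lemma norm_le_head_tail n x : N x <= N (ellp_head n x) + N (ellp_tail n x).
Proof. by rewrite -{1}(head_add_tail n x) ellp_normD. Qed.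

Lemma tailZ n (c : R[i]) x : ellp_tail n (c *: x) = c *: ellp_tail n x.
Proof.
by apply: ellpP => k; rewrite !(ellpZE, tail_coordE); case: ifP; rewrite ?mulr0.
Qed.

Lemma tailB n x y : ellp_tail n (x - y) = ellp_tail n x - ellp_tail n y.
Proof.
by apply: ellpP => k; rewrite !(ellpBE, tail_coordE); case: ifP; rewrite ?subr0.
Qed.

Lemma norm_tail_le n x : N (ellp_tail n x) <= N x.
Proof.
apply: ellp_norm_mono => k /=; rewrite /tail_seq; case: ifP => // _.
by rewrite Normc.normc0 normc_ge0.
Qed.

Let psum_split x n m :
  psum x (n + m) = psum x n + psum (ellp_tail n x) (n + m).
Proof.
rewrite {1 3}/psum !big_split_ord /= [X in _ = _ + (X + _)]big1 => [|k _]; last first.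
  by rewrite /tail_seq /= ltn_ord Normc.normc0 powR0.
rewrite add0r; congr (_ + _); apply: eq_bigr => k _.
by rewrite /tail_seq /= ltnNge leq_addr.
Qed.

(** Additivity of the [p]-th power of the norm over disjoint supports. *)
Lemma norm_powR_split n x : N x `^ p = psum x n + N (ellp_tail n x) `^ p.
Proof.
apply/eqP; rewrite eq_le; apply/andP; split.
  apply: norm_le_psum => m; apply: (@le_trans _ _ (psum x (n + m))).
    by rewrite psum_mono// leq_addl.
  by rewrite psum_split lerD2l psum_le_norm.
rewrite -lerBrDl; apply: norm_le_psum => m.
apply: (@le_trans _ _ (psum (ellp_tail n x) (n + m))).
  by rewrite psum_mono// leq_addl.
by rewrite lerBrDl -psum_split psum_le_norm.
Qed.

Lemma tail_powR_small x (e : R) : 0 < e ->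
  exists n, forall m, (n <= m)%N -> N (ellp_tail m x) `^ p < e.
Proof.
move=> e0.
have [n xn] : exists n, N x `^ p - e < psum x n.
  apply: contrapT => /forallNP h.
  have : N x `^ p <= N x `^ p - e.
    by apply: norm_le_psum => n; rewrite leNgt; apply/negP/h.
  by rewrite leNgt ltrBlDr ltrDl e0.
exists n => m nm.
have := norm_powR_split m x.
have := psum_mono (x : nat -> R[i]) nm.
by move=> h1 h2; move: xn; rewrite h2; lra.
Qed.

Lemma tail_small x (e : R) : 0 < e ->
  exists n, forall m, (n <= m)%N -> N (ellp_tail m x) < e.
Proof.
move=> e0; have [n xn] := tail_powR_small x (powR_gt0 p e0).
exists n => m /xn; apply: contraTT; rewrite -!leNgt => h.
by rewrite ler_powRl// ltW.
Qed.

Let psum_indicator_le1 k n : psum (fun j => (j == k)%:R) n <= 1.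
Proof.
rewrite /psum; have [kn|nk] := ltnP k n.
  rewrite (bigD1 (Ordinal kn))//= eqxx Normc.normc1 powR1 big1 ?addr0// => j jk.
  have -> : (j == k :> nat) = false by apply/negbTE.
  by rewrite Normc.normc0 powR0.
rewrite big1// => j _; rewrite ltn_eqF ?Normc.normc0 ?powR0//.
exact: leq_trans (ltn_ord j) nk.
Qed.

Lemma basis_subproof k : (fun j => (j == k)%:R : R[i]) \in in_ellp p1.
Proof. exact: mem_ellp (psum_indicator_le1 k). Qed.
Definition ellp_basis k : X := Ellp (basis_subproof k).

Lemma basisE k j : ellp_basis k j = (j == k)%:R. Proof. by []. Qed.

Lemma head_basis n x : ellp_head n x = \sum_(k < n) x k *: ellp_basis k.
Proof.
apply: ellpP => j; rewrite ellp_sumE headE; case: ifPn => jn.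
  rewrite (bigD1 (Ordinal jn)) //.
  rewrite ellpZE basisE eqxx mulr1 big1 => [/=|i ij]; first by rewrite addr0.
  rewrite ellpZE basisE; have -> : (j == i) = false; last by rewrite mulr0.
  by rewrite eq_sym; apply/negbTE.
rewrite big1// => i _; rewrite ellpZE basisE gtn_eqF ?mulr0//.
by rewrite (leq_trans (ltn_ord i))// leqNgt.
Qed.

Lemma norm_basis k : N (ellp_basis k) = 1.
Proof.
apply/eqP; rewrite eq_le; apply/andP; split; last first.
  by have := coord_le_norm (ellp_basis k) k; rewrite basisE eqxx Normc.normc1.
apply: ler_powRlP; rewrite ?ellp_norm_ge0// powR1.
by apply: norm_le_psum => n; exact: psum_indicator_le1.
Qed.

Lemma norm_head_sum n x : N (ellp_head n x) <= \sum_(k < n) modc (x k).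
Proof.
rewrite head_basis; apply: le_trans (ellp_norm_sum _ _ _) _.
by apply: ler_sum => k _; rewrite ellp_normZ norm_basis mulr1.
Qed.

End ellp_coordinates.

(** * Strong* convergence by rows and columns *)

Section complex_convergence.
Variable R : realType.

Lemma normC_modc (z : R[i]) : `|z| = (Normc.normc z)%:C%C.
Proof. by rewrite normc_def; case: z. Qed.

Lemma cvg_realP (V : normedModType R[i]) (T : Type) (F : set_system T)
    (f : T -> V) (l : V) : Filter F ->
  f @ F --> l <->
  forall e : R, 0 < e -> \forall t \near F, `|l - f t| < e%:C%C.
Proof.
move=> FF; split=> [/cvgrPdist_lt h e e0|h]; first by apply: h; rewrite ltcR.
apply/cvgrPdist_lt => -[a b]; rewrite ltcE /= => /andP[/eqP -> a0].
exact: h.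
Qed.

End complex_convergence.

Section row_column_convergence.
Variables (R : realType) (p : R) (p1 : 1 <= p).
Hypothesis p_gt1 : 1 < p.
Local Notation X := (ellp p1).
Local Notation L := (bop X X).
Local Notation modc := (@Normc.normc R).
Local Notation N := (@ellp_norm R p p1).
Implicit Types (x : X) (y : dual X) (S T : L).

Let p_gt0 : 0 < p. Proof. exact: lt_trans p_gt1. Qed.
Let pB1_gt0 : 0 < p - 1. Proof. by rewrite subr_gt0. Qed.

Lemma dual_le y x : modc (y x) <= opnorm y * N x.
Proof.
by have := opnormP y x; rewrite normC_modc normC_ellp -rmorphM lecR.
Qed.

Lemma contraction_le T x : `|T| <= 1 -> N (T x) <= N x.
Proof.
rewrite bop_normE -(rmorph1 (real_complex R)) lecR => T1.
have := opnormP T x; rewrite !normC_ellp -rmorphM lecR => /le_trans; apply.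
by rewrite ler_piMl// ellp_norm_ge0.
Qed.

Lemma exists_small_powR (K e : R) : 0 <= K -> 0 < e ->
  exists2 s, 0 < s & K * s `^ (p - 1) <= e.
Proof.
move=> K0 e0; have K1 : 0 < K + 1 by rewrite ltr_wpDl.
exists ((e / (K + 1)) `^ (p - 1)^-1); first by rewrite powR_gt0// divr_gt0.
rewrite powRK_gt0 ?gt_eqF//; last by rewrite divr_ge0// ltW.
by rewrite mulrA ler_pdivrMr// mulrC ler_wpM2l ?(ltW e0)// lerDl.
Qed.

(** The perturbation lives on the coordinates from [n] on, where [u] itself has
    norm at most [s]; so it costs [O(s^p)], which is [o(s)]. *)
Lemma norm_perturb_tail (n : nat) (u x : X) (s : R) : 0 < s ->
  N (ellp_tail n u) <= s -> N x <= 1 ->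
  N (u + s%:C%C *: ellp_tail n x) `^ p <= N u `^ p + (2 * s) `^ p.
Proof.
move=> s0 us x1; rewrite (norm_powR_split n); apply: lerD.
  rewrite (_ : psum _ _ _ = psum p u n) ?psum_le_norm//.
  apply: eq_bigr => k _; rewrite ellpDE ellpZE tail_coordE ltn_ord.
  by rewrite mulr0 addr0.
apply: ler_powRl; rewrite ?(ltW p_gt0) ?ellp_norm_ge0//.
have -> : ellp_tail n (u + s%:C%C *: ellp_tail n x) =
    ellp_tail n u + s%:C%C *: ellp_tail n x.
  apply: ellpP => k; rewrite !(ellpDE, ellpZE, tail_coordE).
  by case: (k < n)%N; rewrite ?mulr0 ?addr0.
apply: le_trans (ellp_normD _ _) _; rewrite mulr_natl mulr2n lerD//.
rewrite ellp_normZ normcR ?(ltW s0)// ler_piMr ?(ltW s0)//.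
exact: le_trans (norm_tail_le _ _) x1.
Qed.

Lemma unimodular_rotation (z : R[i]) :
  exists2 c, modc c = 1 & c * z = (modc z)%:C%C.
Proof.
have [->|z0] := eqVneq z 0.
  by exists 1; rewrite ?Normc.normc1// mulr0 Normc.normc0.
exists (`|z| / z); last by rewrite -mulrA mulVf// mulr1 normC_modc.
apply: (@complexI R); rewrite -normC_modc.
by rewrite normrM normfV normr_id mulfV// normr_eq0.
Qed.

(** The dual norm of a functional on the coordinates from [n] on tends to [0]. Let
    [u] nearly norm [y]. For [x] of norm [1] supported far away,
    [y (u + s x)] is about [a + s y(x)], where [a] is the norm of [y], and is at
    most [a (1 + (2 s)^p)]; hence [y(x)] is of order [s^(p-1)]. *)
Lemma dual_tail_small y (e : R) : 0 < e ->
  exists n, forall m, (n <= m)%N -> forall x, modc (y (ellp_tail m x)) <= e * N x.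
Proof.
move=> e0; set a := opnorm y.
have a0 : 0 <= a := opnorm_ge0 y.
have [s s0 sK] : exists2 s, 0 < s & (1 + a * 2 `^ p) * s `^ (p - 1) <= e.
  by apply: exists_small_powR => //; rewrite addr_ge0// mulr_ge0// powR_ge0.
have sp0 : 0 < s `^ p by exact: powR_gt0.
have [u [u1 yu]] : exists u : X, N u <= 1 /\ a - s `^ p < modc (y u).
  apply: contrapT => /forallNP h.
  suff : a <= a - s `^ p by rewrite leNgt ltrBlDr ltrDl sp0.
  apply: opnorm_le_ub => x.
  rewrite ellp_norm_le1 normC_modc lecR => x1.
  by rewrite leNgt; apply/negP => xy; apply: (h x).
have [n nu] := tail_small u s0.
exists n => m nm.
have unit x : N x <= 1 -> modc (y (ellp_tail m x)) <= e.
  move=> x1.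
  (* Unimodular factors make both values of [y] nonnegative, so that they add
     up without cancellation. *)
  have [c c1 cyu] := unimodular_rotation (y u).
  have [d d1 dyx] := unimodular_rotation (y (ellp_tail m x)).
  pose z : X := c *: u + s%:C%C *: ellp_tail m (d *: x).
  have yz : y z = (modc (y u) + s * modc (y (ellp_tail m x)))%:C%C.
    rewrite linearD !linearZ tailZ linearZ /= rmorphD rmorphM /=.
    by rewrite -cyu -dyx.
  have nz : N z <= 1 + (2 * s) `^ p.
    have r1 : 1 <= 1 + (2 * s) `^ p by rewrite lerDl powR_ge0.
    apply: (ler_powRlP p1); rewrite ?ellp_norm_ge0 ?(le_trans _ r1)//.
    (* [1 + (2 s)^p] is at most its own [p]-th power. *)
    apply: le_trans (le1r_powR r1 p1).
    apply: le_trans (norm_perturb_tail s0 _ _) _.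
    - by rewrite tailZ ellp_normZ c1 mul1r ltW// nu.
    - by rewrite ellp_normZ d1 mul1r.
    rewrite lerD2r ellp_normZ c1 mul1r.
    have /= := ler_powRl (ltW p_gt0) (ellp_norm_ge0 u) u1.
    by rewrite powR1.
  have := dual_le y z; rewrite yz normcR; last first.
    by rewrite addr_ge0 ?normc_ge0// mulr_ge0 ?normc_ge0// ltW.
  move=> /le_trans/(_ (ler_wpM2l a0 nz)).
  rewrite powRM ?(ltW s0)// => h.
  rewrite -(ler_pM2l s0).
  have : s * ((1 + a * 2 `^ p) * s `^ (p - 1)) <= s * e by rewrite ler_wpM2l// ltW.
  rewrite mulrCA mulr_powRB1 ?(ltW s0)//.
  move: h yu; set A := 2 `^ p; set B := s `^ p; set C := modc _; set D := s * _.
  nra.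
move=> x; have [x0|x0] := eqVneq (N x) 0.
  apply: le_trans (dual_le _ _) _; rewrite x0 mulr0.
  rewrite (_ : N _ = 0) ?mulr0//; apply/eqP.
  by rewrite eq_le ellp_norm_ge0 andbT -x0 norm_tail_le.
have x_gt0 : 0 < N x by rewrite lt_neqAle eq_sym x0 ellp_norm_ge0.
have := unit ((N x)^-1%:C%C *: x).
rewrite ellp_normZ normcR ?invr_ge0 ?(ltW x_gt0)// mulVf// => /(_ (lexx _)).
rewrite tailZ linearZ Normc.normcM normcR ?invr_ge0 ?(ltW x_gt0)//.
by rewrite mulrC ler_pdivrMr.
Qed.

Lemma coord_subproof k :
  (fun x : X => x k : R[i]^o) \in @bounded_linear R X R[i]^o.
Proof.
apply/asboolP; split=> [a x y|]; first by [].
exists 1 => x; rewrite mul1r normC_modc normC_ellp lecR.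
exact: coord_le_norm.
Qed.

Definition ellp_coord k : dual X := Bop (coord_subproof k).

(** Uniform boundedness reduces the strong topology to the unit vectors, whose
    span is dense, and the dual strong topology to the coordinate functionals,
    whose span is norm-dense in the dual by [dual_tail_small]. *)
Lemma cvg_SOTs_of_rows_columns (F : set_system L) T : Filter F ->
  `|T| <= 1 -> (\forall S \near F, `|S : L| <= 1) ->
  (forall j e, 0 < e ->
    \forall S \near F, N ((S : L) (ellp_basis p1 j) - T (ellp_basis p1 j)) < e) ->
  (forall k e, 0 < e ->
    \forall S \near F, forall x : X, modc (((S : L) x - T x) k) <= e * N x) ->
  F --> (T : Topological.Pack (SOTs X)).
Proof.
move=> FF T1 F1 cols rows; apply/SOTs_cvgP; split.
  apply/SOT_cvgP => x; apply/cvg_realP => e e0.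
  have e4 : 0 < e / 4 by rewrite divr_gt0.
  have [n nx] := tail_small x e4.
  have d0 : 0 < e / 4 / (n%:R * N x + 1).
    by rewrite divr_gt0// ltr_wpDl// mulr_ge0// ellp_norm_ge0.
  have : \forall S \near F, forall j : 'I_n,
      N ((S : L) (ellp_basis p1 j) - T (ellp_basis p1 j)) < e / 4 / (n%:R * N x + 1).
    by apply: filter_forall => j; exact: cols.
  apply: filterS2 F1 => S S1 Sj.
  rewrite normC_ellp ltcR.
  have -> : T x - S x = - (S (ellp_head n x) - T (ellp_head n x) +
      (S (ellp_tail n x) - T (ellp_tail n x))).
    rewrite opprD !opprB -{1 2}(head_add_tail n x).
    by rewrite (linearD T) (linearD S) opprD addrACA.
  rewrite ellp_normN.
  apply: le_lt_trans (ellp_normD _ _) _.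
  have h1 : N (S (ellp_head n x) - T (ellp_head n x)) <= e / 4.
    rewrite head_basis (linear_sum S) (linear_sum T) -sumrB.
    apply: le_trans (ellp_norm_sum _ _ _) _.
    apply: (@le_trans _ _ (\sum_(j < n) (N x * (e / 4 / (n%:R * N x + 1))))).
      apply: ler_sum => j _; rewrite (linearZZ S) (linearZZ T) -scalerBr ellp_normZ.
      apply: ler_pM; rewrite ?normc_ge0 ?ellp_norm_ge0 ?coord_le_norm//.
      by rewrite ltW// Sj.
    rewrite sumr_const card_ord -[leLHS]mulr_natl [leLHS]mulrA [leLHS]mulrA.
    rewrite ler_pdivrMr.
      by rewrite mulrC ler_wpM2l ?(ltW e4)// lerDl.
    by rewrite ltr_wpDl// mulr_ge0// ellp_norm_ge0.
  have h2 : N (S (ellp_tail n x) - T (ellp_tail n x)) <= e / 4 + e / 4.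
    apply: le_trans (ellp_normB _ _) _.
    by apply: lerD; apply: le_trans (contraction_le _ _) _ => //; rewrite ltW ?nx.
  lra.
apply/SOTd_cvgP => y; apply/cvg_realP => e e0.
have e4 : 0 < e / 4 by rewrite divr_gt0.
have [n ny] := dual_tail_small y e4.
pose K := \sum_(k < n) modc (y (ellp_basis p1 k)).
have K0 : 0 <= K by apply: sumr_ge0 => *; exact: normc_ge0.
have d0 : 0 < e / 4 / (K + 1) by rewrite divr_gt0// ltr_wpDl.
have : \forall S \near F, forall k : 'I_n, forall x : X,
    modc (((S : L) x - T x) k) <= e / 4 / (K + 1) * N x.
  by apply: filter_forall => k; exact: rows.
apply: filterS2 F1 => S S1 Sk.
rewrite bop_normE ltcR; apply: (@le_lt_trans _ _ (3 * (e / 4))); last by lra.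
apply: opnorm_le_ub => x.
rewrite ellp_norm_le1 normC_modc lecR => x1.
rewrite -normcN (_ : - _ = y (S x - T x)); last first.
  by rewrite (linearB y) -[RHS]opprB.
set z : X := S x - T x.
rewrite -(head_add_tail n z) linearD.
apply: le_trans (le_normcD _ _) _.
have h1 : modc (y (ellp_head n z)) <= e / 4.
  rewrite head_basis linear_sum.
  apply: (@le_trans _ _ (\sum_(k < n) modc (z k) * modc (y (ellp_basis p1 k)))).
    apply: le_trans (normc_sum _ _ _) _.
    by apply: ler_sum => k _; rewrite linearZ Normc.normcM.
  apply: (@le_trans _ _ (e / 4 / (K + 1) * K)).
    rewrite mulr_sumr; apply: ler_sum => k _; rewrite ler_wpM2r ?normc_ge0//.
    by apply: le_trans (Sk k x) _; rewrite ler_piMr// ltW.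
  by rewrite mulrAC ler_pdivrMr ?ltr_wpDl// ler_wpM2l ?(ltW e4)// lerDl.
have h2 : modc (y (ellp_tail n z)) <= e / 4 + e / 4.
  apply: le_trans (ny _ (leqnn n) z) _.
  have : N z <= 2.
    apply: le_trans (ellp_normB _ _) _.
    by apply: lerD; apply: le_trans (contraction_le _ _) x1.
  nra.
lra.
Qed.

End row_column_convergence.

(** * Estimates for positive operators *)

Section continuity_points.
Variables (R : realType) (p : R) (p1 : 1 <= p).
Hypothesis p_gt1 : 1 < p.
Local Notation X := (ellp p1).
Local Notation L := (bop X X).
Local Notation modc := (@Normc.normc R).
Local Notation N := (@ellp_norm R p p1).
Implicit Types (x y w u : X) (S T : L).

Let p_gt0 : 0 < p. Proof. exact: lt_trans p_gt1. Qed.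
Let pB1_gt0 : 0 < p - 1. Proof. by rewrite subr_gt0. Qed.

Lemma le_normc (a b : R[i]) : 0 <= a -> a <= b -> modc a <= modc b.
Proof.
move=> a0 ab; have b0 : 0 <= b := le_trans a0 ab.
by rewrite -lecR !ge0_normcK.
Qed.

Lemma positive_op_le S x y k : positive_op S ->
  (forall j, x j <= y j) -> S x k <= S y k.
Proof.
move=> S0 xy; rewrite -subr_ge0 -ellpBE -(linearB S).
by apply: S0 => j; rewrite ellpBE subr_ge0.
Qed.

Lemma abs_subproof x : (fun k => (modc (x k))%:C%C) \in in_ellp p1.
Proof. by apply: (@mem_ellp_le _ _ _ _ x) => k; rewrite normcR// normc_ge0. Qed.
Definition ellp_abs x : X := Ellp (abs_subproof x).

Lemma ellp_absE x k : ellp_abs x k = (modc (x k))%:C%C. Proof. by []. Qed.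

Lemma norm_abs x : N (ellp_abs x) = N x.
Proof.
by apply/eqP; rewrite eq_le; apply/andP; split; apply: ellp_norm_mono => k;
  rewrite ellp_absE normcR// normc_ge0.
Qed.

Lemma abs_ge0 x : ellp_ge0 (ellp_abs x).
Proof. by move=> k; rewrite ellp_absE ler0c normc_ge0. Qed.

Lemma basis_ge0 k : ellp_ge0 (ellp_basis p1 k).
Proof. by move=> j; rewrite basisE ler0n. Qed.

(** The triangle inequality on finitely supported vectors, extended to all vectors
    by continuity of [S]. *)
Lemma positive_op_abs S x k : positive_op S ->
  modc (S x k) <= modc (S (ellp_abs x) k).
Proof.
move=> S0; apply/ler_addgt0Pr => e e0.
have S1 : 0 < opnorm S + 1 by rewrite ltr_wpDl// opnorm_ge0.
have [n nx] := tail_small x (divr_gt0 e0 S1).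
rewrite -{1}(head_add_tail n x) (linearD S) ellpDE.
apply: le_trans (le_normcD _ _) _; apply: lerD; last first.
  apply: le_trans (coord_le_norm _ _) _.
  have := opnormP S (ellp_tail n x); rewrite !normC_ellp -rmorphM lecR => /le_trans.
  apply; have := nx _ (leqnn n); rewrite ltr_pdivlMr// => /ltW; apply: le_trans.
  by rewrite mulrC ler_wpM2l ?ellp_norm_ge0// lerDl.
rewrite head_basis (linear_sum S) ellp_sumE.
apply: (@le_trans _ _ (\sum_(j < n) modc (x j) * modc (S (ellp_basis p1 j) k))).
  apply: le_trans (normc_sum _ _ _) _.
  by apply: ler_sum => j _; rewrite (linearZZ S) ellpZE Normc.normcM.
rewrite -lecR ge0_normcK; last by apply: S0; exact: abs_ge0.
rewrite rmorph_sum /=.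
apply: (@le_trans _ _ (S (ellp_head n (ellp_abs x)) k)); last first.
  apply: positive_op_le => // j; rewrite headE; case: ifP => // _.
  exact: abs_ge0.
rewrite head_basis (linear_sum S) ellp_sumE; apply: ler_sum => j _.
rewrite (linearZZ S) ellpZE ellp_absE rmorphM /=.
by rewrite (ge0_normcK (S0 _ (@basis_ge0 j) k)).
Qed.

(** Positivity of [S] applied to [u j *: ellp_basis p1 j <= u]. *)
Lemma positive_op_basis_le S u j k : positive_op S -> (forall i, 0 < u i) ->
  modc (S (ellp_basis p1 j) k) <= (modc (u j))^-1 * modc (S u k).
Proof.
move=> S0 u0.
have uj : 0 < modc (u j) by rewrite -ltcR ge0_normcK// ltW.
rewrite ler_pdivlMl// -Normc.normcM -ellpZE -(linearZZ S).
apply: le_normc.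
  by apply: S0 => i; rewrite ellpZE mulr_ge0 ?basis_ge0// ltW.
apply: positive_op_le => // i; rewrite ellpZE basisE.
by case: eqP => [->|_]; rewrite ?mulr1// mulr0 ltW.
Qed.

Lemma norm_tail_basis_le S u j n : positive_op S -> (forall i, 0 < u i) ->
  N (ellp_tail n (S (ellp_basis p1 j))) <= (modc (u j))^-1 * N (ellp_tail n (S u)).
Proof.
move=> S0 u0.
have uj : 0 < modc (u j) by rewrite -ltcR ge0_normcK// ltW.
have uj' : 0 <= (modc (u j))^-1 by rewrite invr_ge0 ltW.
rewrite -[X in X * _](normcR uj') -ellp_normZ; apply: ellp_norm_mono => k.
rewrite ellpZE Normc.normcM normcR// !tail_coordE; case: ifP => _.
  by rewrite Normc.normc0 mulr0.
exact: positive_op_basis_le.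
Qed.

Lemma norm_powR_increment x y k (a : R) : 0 <= a ->
  (forall j, modc (x j) <= modc (y j)) -> modc (x k) + a <= modc (y k) ->
  N x `^ p + p * modc (x k) `^ (p - 1) * a <= N y `^ p.
Proof.
move=> a0 xy xyk; rewrite -lerBrDr; apply: norm_le_psum => n.
rewrite lerBrDr.
set m := (n + k.+1)%N.
have km : (k < m)%N by rewrite leq_addl.
apply: le_trans (psum_le_norm y m).
apply: (@le_trans _ _ (psum p x m + p * modc (x k) `^ (p - 1) * a)).
  by rewrite lerD2r psum_mono// leq_addr.
rewrite /psum (bigD1 (Ordinal km))//= [leRHS](bigD1 (Ordinal km))//= addrAC.
apply: lerD; last first.
  by apply: ler_sum => j _; rewrite ler_powRl ?normc_ge0// ltW.
apply: le_trans (ler_powRl (ltW p_gt0) _ xyk); last first.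
  by rewrite addr_ge0// normc_ge0.
have := powR_tangent p_gt1 (normc_ge0 (x k))
  (addr_ge0 (normc_ge0 (x k)) a0).
by rewrite addrAC subrr add0r.
Qed.

(** The estimate of a row far away: [S (u + s x)] is compared with [S u], from
    below by convexity at the coordinate [k] and from above by contractivity. *)
Lemma row_tail_bound S u n k (s eta c : R) : positive_op S -> `|S| <= 1 ->
  (forall i, 0 < u i) -> 0 < s -> N (ellp_tail n u) <= s ->
  N u `^ p - eta <= N (S u) `^ p -> 0 < c -> c <= modc (S u k) ->
  forall x, N x <= 1 ->
  p * c `^ (p - 1) * (s * modc (S (ellp_tail n x) k)) <= eta + (2 * s) `^ p.
Proof.
move=> S0 S1 u0 s0 us Su c0 cSu x x1.
set z := ellp_tail n (ellp_abs x).
have z0 : ellp_ge0 z.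
  by move=> j; rewrite tail_coordE; case: ifP => // _; exact: abs_ge0.
have zE : ellp_abs (ellp_tail n x) = z.
  apply: ellpP => j; rewrite ellp_absE !tail_coordE.
  by case: ifP => // _; rewrite Normc.normc0.
have u0' : ellp_ge0 u by move=> i; rewrite ltW.
have xz : modc (S (ellp_tail n x) k) <= modc (S z k).
  by rewrite -zE; exact: positive_op_abs.
pose a := s * modc (S z k).
have a0 : 0 <= a by rewrite mulr_ge0 ?normc_ge0// ltW.
have up : N (S (u + s%:C%C *: z)) `^ p <= N u `^ p + (2 * s) `^ p.
  have x1' : N (ellp_abs x) <= 1 by rewrite norm_abs.
  apply: le_trans (norm_perturb_tail p_gt1 s0 us x1').
  by apply: ler_powRl; rewrite ?ellp_norm_ge0 ?contraction_le// ltW.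
have low : N (S u) `^ p + p * modc (S u k) `^ (p - 1) * a <=
    N (S (u + s%:C%C *: z)) `^ p.
  apply: norm_powR_increment => // [j|].
    apply: le_normc; first exact: S0.
    apply: positive_op_le => // i; rewrite ellpDE ellpZE lerDl mulr_ge0//.
    by rewrite ler0c ltW.
  have uz0 : ellp_ge0 (u + s%:C%C *: z).
    by move=> i; rewrite ellpDE ellpZE addr_ge0 ?mulr_ge0// ler0c ltW.
  rewrite -lecR rmorphD /= (ge0_normcK (S0 _ u0' k)) (ge0_normcK (S0 _ uz0 k)).
  by rewrite /a rmorphM /= (ge0_normcK (S0 _ z0 k)) (linearD S) (linearZZ S).
have : p * c `^ (p - 1) * (s * modc (S (ellp_tail n x) k)) <=
    p * modc (S u k) `^ (p - 1) * a.
  apply: ler_pM; rewrite ?mulr_ge0 ?powR_ge0 ?normc_ge0 ?(ltW p_gt0) ?(ltW s0)//.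
    by rewrite ler_wpM2l ?(ltW p_gt0)// ler_powRl ?(ltW pB1_gt0) ?(ltW c0).
  by rewrite /a ler_wpM2l// ltW.
lra.
Qed.

End continuity_points.

(** * Operators with a norming vector are points of continuity *)

Section norming_operators.
Variables (R : realType) (p : R) (p1 : 1 <= p).
Hypothesis p_gt1 : 1 < p.
Local Notation X := (ellp p1).
Local Notation L := (bop X X).
Local Notation modc := (@Normc.normc R).
Local Notation N := (@ellp_norm R p p1).
Implicit Types (x y w u : X) (S T : L).

Let p_gt0 : 0 < p. Proof. exact: lt_trans p_gt1. Qed.

Lemma WOT_coord T x k (e : R) : 0 < e ->
  \forall S \near @nbhs _ (Topological.Pack (WOT X)) T,
    modc (((S : L) x - T x) k) < e.
Proof.
move=> e0.
have /(_ x (ellp_coord p1 k))/cvg_realP/(_ e e0) :=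
  (WOT_cvgP T (nbhs_filter (T : Topological.Pack (WOT X)))).1 (fun U TU => TU).
apply: filterS => S; rewrite normC_modc ltcR.
by rewrite ellpBE -(opprB (T x k)) normcN.
Qed.

Lemma dist_normc (a b : R[i]) : `|modc a - modc b| <= modc (a - b).
Proof.
have h (c d : R[i]) : modc c - modc d <= modc (c - d).
  by rewrite lerBlDr -{1}(subrK d c) le_normcD.
by rewrite ler_norml h andbT lerNl opprB -[leRHS]normcN opprB h.
Qed.

Lemma WOT_psum T x n (e : R) : 0 < e ->
  \forall S \near @nbhs _ (Topological.Pack (WOT X)) T,
    `|psum p (T x) n - psum p ((S : L) x) n| < e.
Proof.
move=> e0.
set F := nbhs _.
have FF : Filter F := nbhs_filter (T : Topological.Pack (WOT X)).
have : (fun S : L => \sum_(k < n) `|modc (S x k)| `^ p) @ F -->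
    \sum_(k < n) `|modc (T x k)| `^ p.
  apply: cvg_sum_fct => k _.
  apply: (@cvg_comp _ _ _ (fun S : L => modc (S x k)) (fun t : R => `|t| `^ p)
    _ (nbhs (modc (T x k)))); last exact: norm_powR_continuous.
  apply/cvgrPdist_lt => d d0.
  apply: filterS (WOT_coord T x k d0) => S; apply: le_lt_trans.
  by rewrite distrC dist_normc.
move=> /cvgrPdist_lt/(_ _ e0); apply: filterS => S.
rewrite (_ : \sum_(k < n) `|modc (T x k)| `^ p = psum p (T x) n).
  rewrite (_ : \sum_(k < n) `|modc (S x k)| `^ p = psum p (S x) n)//.
  by apply: eq_bigr => k _; rewrite ger0_norm// normc_ge0.
by apply: eq_bigr => k _; rewrite ger0_norm// normc_ge0.
Qed.

Definition norming T u :=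
  [/\ forall k, 0 < u k, forall k, 0 < T u k & N (T u) = N u].

Lemma near_norm_head T x n (e : R) : 0 < e ->
  \forall S \near @nbhs _ (Topological.Pack (WOT X)) T,
    N (ellp_head n ((S : L) x - T x)) < e.
Proof.
move=> e0; set F := nbhs _.
have FF : Filter F := nbhs_filter (T : Topological.Pack (WOT X)).
have n0 : (0 : R) < n.+1%:R by rewrite ltr0n.
have d0 : 0 < e / n.+1%:R by rewrite divr_gt0.
have : \forall S \near F, forall k : 'I_n,
    modc (((S : L) x - T x) k) < e / n.+1%:R.
  by apply: filter_forall => k; exact: WOT_coord.
apply: filterS => S Sk; apply: le_lt_trans (norm_head_sum _ _) _.
apply: (@le_lt_trans _ _ (\sum_(k < n) e / n.+1%:R)).
  by apply: ler_sum => k _; exact: ltW.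
rewrite sumr_const card_ord -[X in X < _]mulr_natl mulrA ltr_pdivrMr//.
by rewrite mulrC ltr_pM2l// ltr_nat.
Qed.

(** WOT only gives convergence of the coordinates of [S u], but finitely many of
    them already carry almost all of [|T u| = |u|]. *)
Lemma near_norm_image T u (eta : R) : N (T u) = N u -> 0 < eta ->
  \forall S \near @nbhs _ (Topological.Pack (WOT X)) T,
    N u `^ p - eta <= N ((S : L) u) `^ p.
Proof.
move=> Tu eta0.
have eta2 : 0 < eta / 2 by rewrite divr_gt0.
have [n vn] := tail_powR_small (T u) eta2.
apply: filterS (WOT_psum T u n eta2) => S Sn.
have := ler_norm (psum p (T u) n - psum p (S u) n).
have := psum_le_norm (S u) n; have := norm_powR_split n (T u).
rewrite -Tu => ->; have := vn _ (leqnn n); lra.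
Qed.

(** No mass of [S u] escapes to infinity: its first [n] coordinates already have
    nearly the norm of [T u], and its total norm is at most that of
    [u], which is that of [T u]. *)
Lemma near_norm_tail_image T u (e : R) : N (T u) = N u -> 0 < e ->
  exists n, N (ellp_tail n (T u)) < e /\
  \forall S \near @nbhs _ (Topological.Pack (WOT X)) T,
    `|S : L| <= 1 -> N (ellp_tail n ((S : L) u)) < e.
Proof.
move=> Tu e0.
have ep0 : 0 < e `^ p / 2 by rewrite divr_gt0// powR_gt0.
have [n vn] := tail_powR_small (T u) ep0.
have vn' := vn _ (leqnn n).
have lt_e (t : R) : 0 <= t -> t `^ p < e `^ p -> t < e.
  by move=> t0; apply: contraTT; rewrite -!leNgt => et; rewrite ler_powRl// ltW.
exists n; split; first by apply: lt_e; rewrite ?ellp_norm_ge0//; lra.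
apply: filterS (WOT_psum T u n ep0) => S Sn S1.
apply: lt_e; rewrite ?ellp_norm_ge0//.
have := ler_norm (psum p (T u) n - psum p (S u) n).
have := norm_powR_split n (S u); have := norm_powR_split n (T u).
have := ler_powRl (ltW p_gt0) (ellp_norm_ge0 _) (contraction_le u S1).
rewrite -Tu; lra.
Qed.

Lemma norming_continuity_point T u :
  positive_contractions p1 T -> norming T u ->
  forall V : set L, @nbhs _ (Topological.Pack (SOTs X)) T V ->
    @nbhs _ (Topological.Pack (WOT X)) T
      [set S | positive_contractions p1 S -> V S].
Proof.
move=> [T0 T1] [u0 v0 Tu].
pose W : set_system L := @nbhs _ (Topological.Pack (WOT X)) T.
have FW : Filter W := nbhs_filter (T : Topological.Pack (WOT X)).
have umod k : 0 < modc (u k) by rewrite -ltcR ge0_normcK// ltW.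
have vmod k : 0 < modc (T u k) by rewrite -ltcR ge0_normcK// ltW.
suff : within (positive_contractions p1) W --> (T : Topological.Pack (SOTs X)).
  by apply.
apply: cvg_SOTs_of_rows_columns => //.
- by apply: filterS (withinT _ _) => S [].
- move=> j e e0.
  have e4 : 0 < e / 4 by rewrite divr_gt0.
  have ue : 0 < modc (u j) * (e / 4) by rewrite mulr_gt0.
  have [n [vn Sn]] := near_norm_tail_image Tu ue.
  rewrite /within /=.
  apply: filterS2 Sn (near_norm_head T (ellp_basis p1 j) n e4) => S Sn Sh [S0 S1].
  (* The bound on the tail of the column is used for [T] as well as for [S]. *)
  have tl (S' : L) : positive_op S' ->
      N (ellp_tail n (S' u)) < modc (u j) * (e / 4) ->
      N (ellp_tail n (S' (ellp_basis p1 j))) < e / 4.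
    move=> S'0 h; apply: le_lt_trans (norm_tail_basis_le _ _ S'0 u0) _.
    by rewrite ltr_pdivrMl.
  have hS := tl _ S0 (Sn S1); have hT := tl _ T0 vn.
  apply: le_lt_trans (norm_le_head_tail n _) _.
  rewrite tailB.
  have := ellp_normB (ellp_tail n (S (ellp_basis p1 j)))
    (ellp_tail n (T (ellp_basis p1 j))).
  lra.
- move=> k e e0.
  have e4 : 0 < e / 4 by rewrite divr_gt0.
  pose c := modc (T u k) / 2.
  have c0 : 0 < c by rewrite divr_gt0.
  have C0 : 0 < p * c `^ (p - 1) by rewrite mulr_gt0// powR_gt0.
  (* The bound of [row_tail_bound] with [eta = s^p] is [(1 + 2^p) s^p], to be
     divided by [p c^(p-1) s]. *)
  have [s s0 sK] : exists2 s, 0 < s &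
      (1 + 2 `^ p) / (p * c `^ (p - 1)) * s `^ (p - 1) <= e / 4.
    apply: exists_small_powR => //.
    by rewrite divr_ge0 ?(ltW C0)// addr_ge0// powR_ge0.
  have sp0 : 0 < s `^ p by exact: powR_gt0.
  have [n nu] := tail_small u s0.
  have tl (S' : L) : positive_op S' -> `|S'| <= 1 ->
      N u `^ p - s `^ p <= N (S' u) `^ p -> c <= modc (S' u k) ->
      forall x, N x <= 1 -> modc (S' (ellp_tail n x) k) <= e / 4.
    move=> S'0 S'1 S'u cS' x x1.
    have := row_tail_bound p_gt1 S'0 S'1 u0 s0 (ltW (nu _ (leqnn n))) S'u c0 cS' x1.
    rewrite powRM ?(ltW s0)// => h; apply: le_trans sK.
    rewrite mulrAC ler_pdivlMr// -(ler_pM2l s0) mulrCA.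
    rewrite [X in _ <= X]mulrCA mulr_powRB1 ?(ltW s0)//.
    move: h; set A := modc _; set B := p * _; set D := 2 `^ p; set E := s `^ p.
    by move=> h; nra.
  have hT := tl _ T0 T1.
  have {}hT : forall x, N x <= 1 -> modc (T (ellp_tail n x) k) <= e / 4.
    apply: hT; first by rewrite Tu lerBlDr lerDl ltW.
    by rewrite /c; have := vmod k; lra.
  have near_rows : \forall S \near W, forall j : 'I_n,
      modc (((S : L) (ellp_basis p1 j) - T (ellp_basis p1 j)) k) < e / 4 / n.+1%:R.
    by apply: filter_forall => j; apply: WOT_coord; rewrite divr_gt0.
  have near_c : \forall S \near W, c <= modc ((S : L) u k).
    apply: filterS (WOT_coord T u k c0) => S Sk.
    have := le_lt_trans (dist_normc _ _) Sk.
    by rewrite ltr_norml /c => /andP[+ _]; lra.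
  rewrite /within /=.
  apply: filterS3 near_rows near_c (near_norm_image Tu sp0) => S Sj Sc Su [S0 S1] x.
  pose y : dual X := adjoint (S - T) (ellp_coord p1 k).
  have yE z : y z = (S z - T z) k by [].
  suff : opnorm y <= e.
    move=> ye; apply: le_trans (dual_le y x) _.
    by rewrite ler_wpM2r// ellp_norm_ge0.
  apply: opnorm_le_ub => z.
  rewrite ellp_norm_le1 normC_modc lecR => z1.
  rewrite -(head_add_tail n z) linearD; apply: le_trans (le_normcD _ _) _.
  have h1 : modc (y (ellp_head n z)) <= e / 4.
    rewrite head_basis linear_sum.
    apply: (@le_trans _ _ (\sum_(j < n) e / 4 / n.+1%:R)).
      apply: le_trans (normc_sum _ _ _) _; apply: ler_sum => j _.
      rewrite (linearZZ y) Normc.normcM; apply: le_trans (ltW (Sj j)).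
      by rewrite ler_piMl ?normc_ge0// (le_trans (coord_le_norm _ _) z1).
    rewrite sumr_const card_ord -[X in X <= _]mulr_natl mulrA ler_pdivrMr//.
    by rewrite mulrC ler_wpM2l ?(ltW e4)// ler_nat.
  have h2 : modc (y (ellp_tail n z)) <= e / 4 + e / 4.
    rewrite yE ellpBE; apply: le_trans (le_normcD _ _) _; rewrite normcN.
    by apply: lerD; [exact: (tl _ S0 S1 Su Sc)|exact: hT].
  lra.
Qed.

End norming_operators.

(** * Bordering a finite matrix so that it attains its norm *)

Section finite_blocks.
Variables (R : realType) (p : R).
Hypothesis p_gt1 : 1 < p.

Let p_gt0 : 0 < p. Proof. exact: lt_trans p_gt1. Qed.
Let pB1_gt0 : 0 < p - 1. Proof. by rewrite subr_gt0. Qed.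

Lemma powR_convex2 (r a b : R) : 0 <= r -> r <= 1 -> 0 <= a -> 0 <= b ->
  ((1 - r) * a + r * b) `^ p <= (1 - r) * a `^ p + r * b `^ p.
Proof.
move=> r0 r1 a0 b0; set m := (1 - r) * a + r * b.
have r1' : 0 <= 1 - r by rewrite subr_ge0.
have m0 : 0 <= m by rewrite addr_ge0// mulr_ge0.
have ha := ler_wpM2l r1' (powR_tangent p_gt1 m0 a0).
have hb := ler_wpM2l r0 (powR_tangent p_gt1 m0 b0).
apply: le_trans (lerD ha hb); rewrite le_eqVlt; apply/orP; left; apply/eqP.
by rewrite /m; ring.
Qed.

Definition block_contraction (m : nat) (B : nat -> nat -> R) :=
  forall x : nat -> R, (forall j, 0 <= x j) ->
  \sum_(k < m) (\sum_(j < m) B k j * x j) `^ p <= \sum_(j < m) x j `^ p.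

(** The subinvariance inequality is homogeneous, so the vector may be scaled
    down. *)
Lemma exists_small_subinvariant_vector (n : nat) (A : nat -> nat -> R) (eta : R) :
  0 < eta -> (forall k j, 0 < A k j) -> block_contraction n.+1 A ->
  exists2 u : nat -> R, (forall j, 0 < u j /\ u j `^ (p - 1) <= eta) &
    forall j, (j < n.+1)%N -> \sum_(k < n.+1) A k j *
      (\sum_(i < n.+1) A k i * u i) `^ (p - 1) <= u j `^ (p - 1).
Proof.
move=> eta0 A0 A1.
have [|x x0|u u0 Au] := @exists_subinvariant_vector R p p_gt1 n (fun k j => A k j).
- by [].
- have := A1 (fun j => x (inord j)) (fun j => x0 _).
  under eq_bigr => k _ do under eq_bigr => j _ do rewrite inord_val.
  by under [leRHS]eq_bigr => j _ do rewrite inord_val.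
pose K := \sum_j u j `^ (p - 1).
have K0 : 0 <= K by apply: sumr_ge0 => *; exact: powR_ge0.
have [t t0 tK] := exists_small_powR p_gt1 K0 eta0.
exists (fun j => t * u (inord j)) => j.
  split; first by rewrite mulr_gt0.
  rewrite powRM ?(ltW t0) ?(ltW (u0 _))// mulrC; apply: le_trans tK.
  rewrite ler_wpM2r ?powR_ge0// /K (bigD1 (inord j))//= lerDl.
  by apply: sumr_ge0 => *; exact: powR_ge0.
move=> jn.
rewrite [leRHS]powRM ?(ltW t0) ?(ltW (u0 _))//.
have := ler_wpM2l (powR_ge0 t (p - 1)) (Au (Ordinal jn)).
rewrite (_ : inord j = Ordinal jn); last by apply: val_inj; rewrite /= inordK.
apply: le_trans; rewrite mulr_sumr; apply: ler_sum => k _ /=.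
rewrite mulrCA -powRM ?(ltW t0)//; last first.
  by apply: sumr_ge0 => i _; rewrite mulr_ge0// ltW.
rewrite mulr_sumr le_eqVlt; apply/orP; left; apply/eqP.
congr (_ * (_ `^ _)); apply: eq_bigr => i _; rewrite inord_val; ring.
Qed.

(** The zero column beside [A] leaves [A u] unchanged when [u] receives one more
    coordinate, so that only the new row has to be chosen. *)
Definition bordered (m : nat) (A : nat -> nat -> R) (c : nat -> R) (d : R) k j :=
  if (k < m)%N then (if (j < m)%N then A k j else 0)
  else (if (j < m)%N then c j else d).

Lemma sum_bordered_lt m A c d (x : nat -> R) k : (k < m)%N ->
  \sum_(j < m.+1) bordered m A c d k j * x j = \sum_(j < m) A k j * x j.
Proof.
move=> km; rewrite big_ord_recr /= /bordered km ltnn mul0r addr0.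
by apply: eq_bigr => j _; rewrite ltn_ord.
Qed.

Lemma sum_bordered_eq m A c d (x : nat -> R) :
  \sum_(j < m.+1) bordered m A c d m j * x j = \sum_(j < m) c j * x j + d * x m.
Proof.
rewrite big_ord_recr /= /bordered ltnn; congr (_ + _).
by apply: eq_bigr => j _; rewrite ltn_ord.
Qed.

(** Let [v = A u], let [g] be the transpose of [A] applied to [v^(p-1)], and put
    [1] as last coordinate of the vector. The last coordinate [z] of its image
    and the new row [c], [d] are forced by the equality case of Schur's test,
    [g j + c j z^(p-1) = u j^(p-1)] and [d z^(p-1) = 1]. Then [z] must be
    [c . u + d], that is [z^p = 1 + gam] with [gam = |u|^p - |v|^p >= 0]. In
    particular [z >= 1], so that [c j <= u j^(p-1)] is small. *)
Lemma exists_norming_border (n : nat) (A : nat -> nat -> R) (eta : R) :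
  0 < eta -> (forall k j, 0 < A k j) -> block_contraction n.+1 A ->
  exists c d (u : nat -> R), let B := bordered n.+1 A c d in
  [/\ (forall j, (j < n.+1)%N -> 0 <= c j <= eta) /\ 0 <= d,
      (forall j, 0 < u j),
      (forall k, (k < n.+2)%N -> 0 < \sum_(j < n.+2) B k j * u j),
      \sum_(k < n.+2) (\sum_(j < n.+2) B k j * u j) `^ p =
        \sum_(j < n.+2) u j `^ p
    & block_contraction n.+2 B].
Proof.
move=> eta0 A0 A1; set m := n.+1.
have [u u0 Au] := exists_small_subinvariant_vector eta0 A0 A1.
have {u0}[u0 ueta] : (forall j, 0 < u j) /\ forall j, u j `^ (p - 1) <= eta.
  by split => j; have [] := u0 j.
pose v k := \sum_(j < m) A k j * u j.
pose g j := \sum_(k < m) A k j * v k `^ (p - 1).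
have v0 k : 0 < v k.
  rewrite /v big_ord_recl ltr_pwDl ?mulr_gt0//.
  by apply: sumr_ge0 => j _; rewrite mulr_ge0// ltW.
have g0 j : 0 <= g j.
  by apply: sumr_ge0 => k _; rewrite mulr_ge0 ?powR_ge0// ltW.
have gu j : (j < m)%N -> g j <= u j `^ (p - 1) by exact: Au.
pose gam := \sum_(j < m) u j * (u j `^ (p - 1) - g j).
have gam0 : 0 <= gam.
  by apply: sumr_ge0 => j _; rewrite mulr_ge0 ?subr_ge0 ?gu// ltW.
have ug : \sum_(j < m) u j * g j = \sum_(k < m) v k `^ p.
  under eq_bigr => j _ do rewrite /g mulr_sumr.
  rewrite exchange_big /=; apply: eq_bigr => k _.
  rewrite -(mulr_powRB1 (ltW (v0 k)) p_gt0) /v mulr_suml.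
  by apply: eq_bigr => j _; rewrite mulrA (mulrC (u j)).
have gamE : gam = \sum_(j < m) u j `^ p - \sum_(k < m) v k `^ p.
  rewrite -ug -sumrB; apply: eq_bigr => j _.
  by rewrite mulrBr mulr_powRB1// ltW.
pose z := (1 + gam) `^ p^-1.
have z1 : 0 < 1 + gam by rewrite ltr_pwDl.
have z0 : 0 < z by exact: powR_gt0.
have zp : z `^ p = 1 + gam by rewrite powRK_gt0 ?gt_eqF// ltW.
have zp1 : 0 < z `^ (p - 1) by exact: powR_gt0.
have z_ge1 : 1 <= z.
  rewrite leNgt; apply/negP => zlt1.
  have : z `^ p < 1 `^ p by apply: gt0_ltr_powR; rewrite ?nnegrE ?(ltW z0).
  by rewrite zp powR1 ltNge lerDl gam0.
pose d := (z `^ (p - 1))^-1.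
have d0 : 0 < d by rewrite invr_gt0.
have d1 : d <= 1.
  by rewrite invf_le1//; have := ler_powRl (ltW pB1_gt0) ler01 z_ge1; rewrite powR1.
pose c j := d * (u j `^ (p - 1) - g j).
pose w j := if (j < m)%N then u j else 1.
have w0 j : 0 < w j by rewrite /w; case: ifP.
have wE j : (j < m)%N -> w j = u j by rewrite /w => ->.
have wm : w m = 1 by rewrite /w ltnn.
have Bw k : (k < m)%N -> \sum_(j < m.+1) bordered m A c d k j * w j = v k.
  move=> km; rewrite sum_bordered_lt//; apply: eq_bigr => j _.
  by rewrite wE.
have Bm : \sum_(j < m.+1) bordered m A c d m j * w j = z.
  rewrite sum_bordered_eq wm mulr1.
  under eq_bigr => j _ do rewrite wE// /c -mulrA (mulrC _ (u j)).
  rewrite -mulr_sumr -/gam -{2}(mulr1 d) -mulrDr addrC -zp.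
  by rewrite -(mulr_powRB1 (ltW z0) p_gt0) mulrCA mulVf ?mulr1// gt_eqF.
have c0 j : (j < m)%N -> 0 <= c j.
  by move=> jm; rewrite mulr_ge0 ?(ltW d0)// subr_ge0 gu.
exists c, d, w; split.
- split; last exact: ltW.
  move=> j jm; rewrite c0//=; apply: le_trans (ueta j).
  rewrite /c -[leRHS]mul1r; apply: ler_pM; rewrite ?(ltW d0) ?subr_ge0 ?gu//.
  by rewrite lerBlDr lerDl.
- exact: w0.
- move=> k; rewrite ltnS leq_eqVlt => /orP[/eqP ->|km]; first by rewrite Bm.
  by rewrite Bw.
- rewrite big_ord_recr /= Bm zp.
  rewrite (eq_bigr (fun k : 'I_m => v k `^ p)); last by move=> k _; rewrite Bw.
  rewrite [RHS]big_ord_recr /= wm powR1.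
  rewrite [in RHS](eq_bigr (fun k : 'I_m => u k `^ p)); last by move=> k _; rewrite wE.
  by rewrite gamE; ring.
- move=> x x0; apply: (@schur_test R p p_gt1 _ _
    (fun k j : 'I_m.+1 => bordered m A c d k j) (fun j => w j) (fun j => x j)) => //.
  + move=> k j; rewrite /bordered; case: ifP => _; case: ifP => // jm.
    * exact: ltW.
    * exact: c0.
    * exact: ltW.
  + move=> k; have [km|] := ltnP k m; first by rewrite Bw.
    move=> mk; have -> : k = m :> nat by apply/eqP; rewrite eqn_leq mk -ltnS ltn_ord.
    by rewrite Bm.
  + move=> j; rewrite big_ord_recr /= Bm.
    under eq_bigr => k _ do rewrite Bw//.
    rewrite {2}/bordered ltnn; have [jm|mj] := ltnP j m.
      rewrite (eq_bigr (fun k : 'I_m => A k j * v k `^ (p - 1))); last first.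
        by move=> k _; rewrite /bordered ltn_ord jm.
      rewrite -/(g j) /c wE// mulrAC /d mulVf ?gt_eqF// mul1r.
      by rewrite addrC subrK.
    rewrite big1 ?add0r; last first.
      by move=> k _; rewrite /bordered ltn_ord ltnNge mj /= mul0r.
    rewrite /d mulVf ?gt_eqF//.
    have -> : j = m :> nat by apply/eqP; rewrite eqn_leq mj -ltnS ltn_ord.
    by rewrite wm powR1.
Qed.

End finite_blocks.

(** * Density of the operators with a norming vector *)

Section block_operators.
Variables (R : realType) (p : R) (p1 : 1 <= p).
Hypothesis p_gt1 : 1 < p.
Local Notation X := (ellp p1).
Local Notation L := (bop X X).
Local Notation modc := (@Normc.normc R).
Local Notation N := (@ellp_norm R p p1).
Implicit Types (x y u : X) (S T : L).

Let p_gt0 : 0 < p. Proof. exact: lt_trans p_gt1. Qed.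

Section block_operator.
Variables (m : nat) (B : nat -> nat -> R).
Hypothesis B_ge0 : forall k j, (k < m)%N -> (j < m)%N -> 0 <= B k j.
Hypothesis B_contr : block_contraction p m B.

Definition block_seq (x : nat -> R[i]) k : R[i] :=
  if (k < m)%N then \sum_(j < m) (B k j)%:C%C * x j else x k.

Let block_psum x n : psum p (block_seq x) n <= N x `^ p.
Proof.
have h : psum p (block_seq x) m <= psum p x m.
  apply: le_trans (B_contr (fun j => normc_ge0 (x j))).
  apply: ler_sum => k _; apply: ler_powRl; rewrite ?normc_ge0 ?(ltW p_gt0)//.
  rewrite /block_seq ltn_ord; apply: le_trans (normc_sum _ _ _) _.
  by apply: ler_sum => j _; rewrite Normc.normcM normcR// B_ge0.
apply: le_trans (psum_le_norm x (m + n)).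
apply: (@le_trans _ _ (psum p (block_seq x) (m + n))).
  by rewrite psum_mono// leq_addl.
rewrite /psum !big_split_ord /=; apply: lerD; first exact: h.
by apply: ler_sum => k _; rewrite /block_seq ltnNge leq_addr.
Qed.

Let block_mem x : block_seq x \in in_ellp p1.
Proof. exact: mem_ellp (block_psum x). Qed.

Let block_fun x : X := Ellp (block_mem x).

Let block_bounded : block_fun \in @bounded_linear R X X.
Proof.
apply/asboolP; split=> [a x y|].
  apply: ellpP => k.
  change (block_seq (a *: x + y) k = a * block_seq x k + block_seq y k).
  rewrite /block_seq; case: ifP => // _.
  rewrite mulr_sumr -big_split /=; apply: eq_bigr => j _.
  by rewrite [X in _ * X = _](_ : _ = a * x j + y j)// mulrDr mulrCA.
exists 1 => x; rewrite mul1r !normC_ellp lecR.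
apply: (ler_powRlP p1); rewrite ?ellp_norm_ge0//.
by apply: norm_le_psum => n; exact: block_psum.
Qed.

Definition block_op : L := Bop block_bounded.

Lemma block_opE x k : block_op x k = block_seq x k. Proof. by []. Qed.

Lemma block_op_positive_contraction : positive_contractions p1 block_op.
Proof.
split.
  move=> x x0 k; rewrite block_opE /block_seq; case: ifP => // km.
  by apply: sumr_ge0 => j _; rewrite mulr_ge0// ler0c B_ge0.
rewrite bop_normE -(rmorph1 (real_complex R)) lecR.
apply: opnorm_le_ub => x; rewrite !normC_ellp.
apply: le_trans; rewrite lecR; apply: (ler_powRlP p1); rewrite ?ellp_norm_ge0//.
by apply: norm_le_psum => n; exact: block_psum.
Qed.

End block_operator.

(** The tail only has to be positive and summable to the power [p]: the identity
    part of a block operator preserves the norm of any tail. *)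
Definition ext_seq (m : nat) (w : nat -> R) k : R[i] :=
  ((if (k < m)%N then w k else 2^-1 ^+ k))%:C%C.

Lemma ext_subproof m w : ext_seq m w \in in_ellp p1.
Proof.
apply: (@mem_ellp _ _ _ _ (\sum_(k < m) modc (w k)%:C%C `^ p + 2)) => n.
apply: (@le_trans _ _ (psum p (ext_seq m w) (m + n))).
  by rewrite psum_mono// leq_addl.
rewrite /psum big_split_ord; apply: lerD.
  apply: ler_sum => k _.
  have -> : ext_seq m w (lshift n k) = (w k)%:C%C by rewrite /ext_seq /= ltn_ord.
  exact: lexx.
apply: (@le_trans _ _ (\sum_(k < n) 2^-1 ^+ k)).
  apply: ler_sum => k _.
  have -> : ext_seq m w (rshift m k) = (2^-1 ^+ (m + k))%:C%C.
    by rewrite /ext_seq /= ltnNge leq_addr.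
  rewrite normcR ?exprn_ge0//.
  apply: le_trans (ge1r_powR _ p1) _.
    by rewrite exprn_gt0//= exprn_ile1// invf_le1// ler1n.
  by rewrite exprD ler_piMl ?exprn_ge0// exprn_ile1// invf_le1// ler1n.
suff -> : \sum_(k < n) 2^-1 ^+ k = 2 - 2 * 2^-1 ^+ n :> R.
  by rewrite gerBl mulr_ge0// exprn_ge0.
elim: n => [|n IH]; first by rewrite big_ord0 expr0 mulr1 subrr.
by rewrite big_ord_recr /= IH exprS; lra.
Qed.

Definition ellp_ext m w : X := Ellp (ext_subproof m w).

Lemma extE m w k : ellp_ext m w k = ext_seq m w k. Proof. by []. Qed.

Lemma block_op_norming m B (B0 : forall k j, (k < m)%N -> (j < m)%N -> 0 <= B k j)
    (BC : block_contraction p m B) (u : nat -> R) :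
  (forall j, 0 < u j) -> (forall k, (k < m)%N -> 0 < \sum_(j < m) B k j * u j) ->
  \sum_(k < m) (\sum_(j < m) B k j * u j) `^ p = \sum_(j < m) u j `^ p ->
  norming (block_op B0 BC) (ellp_ext m u).
Proof.
move=> u0 Bu0 Bu.
have ext0 k : 0 < ellp_ext m u k.
  by rewrite extE /ext_seq ltcR; case: ifP => _ //; rewrite exprn_gt0.
have TE k : (k < m)%N ->
    block_op B0 BC (ellp_ext m u) k = (\sum_(j < m) B k j * u j)%:C%C.
  move=> km; rewrite block_opE /block_seq km rmorph_sum /=.
  by apply: eq_bigr => j _; rewrite /ext_seq ltn_ord rmorphM.
have TE' k : (k < m)%N = false -> block_op B0 BC (ellp_ext m u) k = ellp_ext m u k.
  by move=> km; rewrite block_opE /block_seq km.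
split => //.
  move=> k; case km : (k < m)%N; last by rewrite TE'.
  by rewrite TE// ltcR Bu0.
apply: (powR_injective p_gt0); rewrite ?nnegrE ?ellp_norm_ge0//.
rewrite (norm_powR_split m (block_op B0 BC (ellp_ext m u))).
rewrite (norm_powR_split m (ellp_ext m u)); congr (_ + _ `^ p).
  rewrite /psum (eq_bigr (fun k : 'I_m => (\sum_(j < m) B k j * u j) `^ p)).
    rewrite Bu; apply: eq_bigr => j _.
    by rewrite extE /ext_seq ltn_ord normcR// ltW.
  by move=> k _; rewrite TE// normcR// ltW// Bu0.
congr (N _); apply: ellpP => k; rewrite !tail_coordE.
by case km : (k < m)%N; rewrite ?TE'.
Qed.

Definition entry T k j := modc (T (ellp_basis p1 j) k).

Lemma entryE T k j : positive_op T -> T (ellp_basis p1 j) k = (entry T k j)%:C%C.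
Proof. by move=> T0; rewrite ge0_normcK// T0// => i; exact: basis_ge0. Qed.

Lemma entry_le1 T k j : `|T| <= 1 -> entry T k j <= 1.
Proof.
move=> T1; apply: le_trans (coord_le_norm _ _) _.
by rewrite -(norm_basis p1 j) contraction_le.
Qed.

Lemma apply_head T n x k :
  T (ellp_head n x) k = \sum_(j < n) x j * T (ellp_basis p1 j) k.
Proof.
rewrite head_basis (linear_sum T) ellp_sumE; apply: eq_bigr => j _.
by rewrite (linearZZ T).
Qed.

Lemma entry_contraction T m : positive_contractions p1 T ->
  block_contraction p m (entry T).
Proof.
move=> [T0 T1] x x0; set y := ellp_head m (ellp_ext m x).
have yp : N y `^ p <= \sum_(j < m) x j `^ p.
  rewrite (norm_powR_split m).
  have -> : ellp_tail m y = 0.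
    by apply: ellpP => k; rewrite tail_coordE headE; case: (k < m)%N.
  rewrite ellp_norm0 powR0 ?gt_eqF// addr0; apply: ler_sum => j _.
  by rewrite headE ltn_ord extE /ext_seq ltn_ord normcR.
apply: le_trans yp.
apply: le_trans (ler_powRl (ltW p_gt0) (ellp_norm_ge0 _) (contraction_le y T1)).
apply: le_trans (psum_le_norm _ m); apply: ler_sum => k _.
rewrite (_ : T y k = (\sum_(j < m) entry T k j * x j)%:C%C).
  by rewrite normcR//; apply: sumr_ge0 => j _; rewrite mulr_ge0// normc_ge0.
rewrite apply_head rmorph_sum /=; apply: eq_bigr => j _.
by rewrite /ext_seq ltn_ord entryE// rmorphM mulrC.
Qed.

(** The upper left [m * m] block of [T], mixed with the constant matrix [1 / m],
    which is a contraction by Jensen's inequality. The weight [1 / m^2] of the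
    latter changes each of the [m] entries of a row or column by at most
    [1 / m^2], hence the row or column by at most [1 / m] in norm. *)
Definition mixed_entry T (m : nat) k j :=
  (1 - m%:R^-1 ^+ 2) * entry T k j + m%:R^-1 ^+ 2 * m%:R^-1.

Let inv_nat_le1 (m : nat) : (0 < m)%N -> 0 < m%:R^-1 :> R /\ m%:R^-1 <= 1 :> R.
Proof.
by move=> m0; rewrite invr_gt0 ltr0n; split=> //; rewrite invf_le1 ?ltr0n// ler1n.
Qed.

Lemma mixed_entry_gt0 T n k j : 0 < mixed_entry T n.+1 k j.
Proof.
have [m0 m1] := @inv_nat_le1 n.+1 isT.
rewrite /mixed_entry ltr_wpDl ?mulr_gt0 ?exprn_gt0//.
by rewrite mulr_ge0 ?normc_ge0// subr_ge0 exprn_ile1// ltW.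
Qed.

Lemma mixed_entry_dist T n k j : `|T| <= 1 ->
  `|mixed_entry T n.+1 k j - entry T k j| <= n.+1%:R^-1 ^+ 2.
Proof.
move=> T1; have [m0 m1] := @inv_nat_le1 n.+1 isT.
have t1 := entry_le1 k j T1; have t0 : 0 <= entry T k j := normc_ge0 _.
rewrite /mixed_entry; set m := _^-1 in m0 m1 *; set t := entry T k j in t0 t1 *.
have -> : (1 - m ^+ 2) * t + m ^+ 2 * m - t = m ^+ 2 * (m - t) by ring.
rewrite normrM ger0_norm ?exprn_ge0 ?(ltW m0)// ler_piMr ?exprn_ge0 ?(ltW m0)//.
rewrite ler_norml; apply/andP; split; lra.
Qed.

Lemma mixed_entry_contraction T n : positive_contractions p1 T ->
  block_contraction p n.+1 (mixed_entry T n.+1).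
Proof.
move=> PT x x0; set m := n.+1.
have [m0 m1] := @inv_nat_le1 m isT.
set r := m%:R^-1 : R in m0 m1.
have r2 : 0 <= r ^+ 2 by rewrite exprn_ge0// ltW.
have r21 : r ^+ 2 <= 1 by rewrite exprn_ile1// ltW.
pose a k := \sum_(j < m) entry T k j * x j.
pose b := \sum_(j < m) r * x j.
have a0 k : 0 <= a k by apply: sumr_ge0 => j _; rewrite mulr_ge0// normc_ge0.
have b0 : 0 <= b by apply: sumr_ge0 => j _; rewrite mulr_ge0// ltW.
have bp : b `^ p <= r * \sum_(j < m) x j `^ p.
  rewrite mulr_sumr; apply: (powR_jensen p_gt1) => // [i|]; first exact: ltW.
  by rewrite sumr_const card_ord -[LHS]mulr_natl mulfV// pnatr_eq0.
have ap : \sum_(k < m) a k `^ p <= \sum_(j < m) x j `^ p.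
  exact: entry_contraction PT _ _.
apply: (@le_trans _ _
    (\sum_(k < m) ((1 - r ^+ 2) * a k `^ p + r ^+ 2 * b `^ p))).
  apply: ler_sum => k _.
  rewrite (_ : \sum_(j < m) _ = (1 - r ^+ 2) * a k + r ^+ 2 * b).
    exact: powR_convex2.
  rewrite /a /b !mulr_sumr -big_split /=; apply: eq_bigr => j _.
  by rewrite /mixed_entry -/m -/r; ring.
rewrite big_split /= -mulr_sumr sumr_const card_ord -[X in _ + X]mulr_natl.
have mr : m%:R * r = 1 by rewrite mulfV// pnatr_eq0.
set s := \sum_(j < m) x j `^ p in bp ap *.
have h1 : (1 - r ^+ 2) * \sum_(k < m) a k `^ p <= (1 - r ^+ 2) * s.
  by rewrite ler_wpM2l// subr_ge0.
have h2 : m%:R * (r ^+ 2 * b `^ p) <= r ^+ 2 * s.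
  rewrite mulrCA ler_wpM2l//; apply: (@le_trans _ _ (m%:R * (r * s))).
    by rewrite ler_wpM2l.
  by rewrite mulrA mr mul1r.
by apply: le_trans (lerD h1 h2) _; rewrite -mulrDl subrK mul1r.
Qed.

(** The column [j] of [S] differs from that of [T] by the change of the block, by
    the entry of the new row, made at most [1 / m], and by the discarded tail.
    A row [k < m] has no entry outside the block. *)
Lemma exists_norming_approximation T (n : nat) : positive_contractions p1 T ->
  exists2 S, positive_contractions p1 S /\ exists u, norming S u &
  (forall j, (j < n.+1)%N -> N (S (ellp_basis p1 j) - T (ellp_basis p1 j)) <=
     2 * n.+1%:R^-1 + N (ellp_tail n.+1 (T (ellp_basis p1 j)))) /\
  (forall k x, (k < n.+1)%N -> modc ((S x - T x) k) <=
     n.+1%:R^-1 * N x + modc (T (ellp_tail n.+1 x) k)).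
Proof.
move=> PT; have [T0 T1] := PT; set m := n.+1.
have [m0 m1] := @inv_nat_le1 m isT.
set r := m%:R^-1 : R in m0 m1 *.
have mr : m%:R * r = 1 by rewrite mulfV// pnatr_eq0.
have [c [d [u [[c0 d0] u0 Bu0 Bu BC]]]] := exists_norming_border p_gt1 m0
  (mixed_entry_gt0 T n) (mixed_entry_contraction n PT).
set A := mixed_entry T m in Bu0 Bu BC; set B := bordered _ _ _ _ in Bu0 Bu BC.
have B0 k j : (k < m.+1)%N -> (j < m.+1)%N -> 0 <= B k j.
  move=> _ _; rewrite /B /bordered; case: ifP => _; case: ifP => // jm.
    exact/ltW/mixed_entry_gt0.
  by have /andP[] := c0 _ jm.
exists (block_op B0 BC).
  split; first exact: block_op_positive_contraction.
  by exists (ellp_ext m.+1 u); exact: block_op_norming.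
set S := block_op B0 BC.
have Slt x k : (k < m)%N -> S x k = \sum_(j < m) (A k j)%:C%C * x j.
  move=> km; rewrite /S block_opE /block_seq ltnS (ltnW km) big_ord_recr /=.
  rewrite {2}/B /bordered km ltnn mul0r addr0; apply: eq_bigr => j _.
  by rewrite /B /bordered km ltn_ord.
split.
  move=> j jm; apply: le_trans (norm_le_head_tail m _) _.
  have Sbasis k : (k < m)%N -> S (ellp_basis p1 j) k = (A k j)%:C%C.
    move=> km; rewrite Slt// (bigD1 (Ordinal jm)) //=.
    rewrite eqxx mulr1 big1 ?addr0// => i ij.
    rewrite (_ : (i == j :> nat) = false) ?mulr0//.
    by apply: contraNF ij => /eqP ij; apply/eqP/val_inj.
  have h1 : N (ellp_head m (S (ellp_basis p1 j) - T (ellp_basis p1 j))) <= r.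
    apply: le_trans (norm_head_sum _ _) _.
    apply: (@le_trans _ _ (\sum_(k < m) r ^+ 2)).
      apply: ler_sum => k _; rewrite ellpBE Sbasis// entryE// -rmorphB /=.
      by rewrite expr0n addr0 sqrtr_sqr mixed_entry_dist.
    by rewrite sumr_const card_ord -[X in X <= _]mulr_natl expr2 mulrA mr mul1r.
  have h2 : N (ellp_tail m (S (ellp_basis p1 j))) <= r.
    rewrite (_ : ellp_tail m _ = (c j)%:C%C *: ellp_basis p1 m).
      rewrite ellp_normZ norm_basis mulr1; have /andP[cj0 cj1] := c0 _ jm.
      by rewrite normcR.
    apply: ellpP => k; rewrite tail_coordE ellpZE basisE.
    case: ltngtP => [km|mk|->]; rewrite ?mulr0//.
      rewrite /S block_opE /block_seq ltnS leqNgt mk /=.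
      by rewrite gtn_eqF// (leq_trans jm (ltnW mk)).
    rewrite /S block_opE /block_seq ltnS leqnn mulr1 big_ord_recr /=.
    rewrite gtn_eqF// mulr0 addr0 (bigD1 (Ordinal jm)) //=.
    rewrite eqxx mulr1 big1 ?addr0; last first.
      move=> i ij; rewrite (_ : (i == j :> nat) = false) ?mulr0//.
      by apply: contraNF ij => /eqP ij; apply/eqP/val_inj.
    by rewrite /B /bordered ltnn jm.
  have h3 : N (ellp_tail m (S (ellp_basis p1 j) - T (ellp_basis p1 j))) <=
      r + N (ellp_tail m (T (ellp_basis p1 j))).
    by rewrite tailB; apply: le_trans (ellp_normB _ _) _; rewrite lerD2r.
  by apply: le_trans (lerD h1 h3) _; rewrite mulr_natl mulr2n addrA.
move=> k x km.
have -> : (S x - T x) k =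
    \sum_(j < m) (A k j - entry T k j)%:C%C * x j - T (ellp_tail m x) k.
  rewrite ellpBE Slt// -{2}(head_add_tail m x) (linearD T) ellpDE opprD addrA.
  congr (_ - _); rewrite apply_head -sumrB; apply: eq_bigr => j _.
  by rewrite entryE// rmorphB /= mulrBl [x j * _]mulrC.
apply: le_trans (le_normcD _ _) _; rewrite normcN lerD2r.
apply: (@le_trans _ _ (\sum_(j < m) r ^+ 2 * N x)).
  apply: le_trans (normc_sum _ _ _) _; apply: ler_sum => j _.
  rewrite Normc.normcM; apply: ler_pM; rewrite ?normc_ge0 ?coord_le_norm//.
  by rewrite /= expr0n addr0 sqrtr_sqr mixed_entry_dist.
rewrite sumr_const card_ord -[X in X <= _]mulr_natl mulrA expr2 mulrA mr.
by rewrite mul1r.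
Qed.

Lemma norming_dense T (U : set L) : positive_contractions p1 T ->
  @nbhs _ (Topological.Pack (SOTs X)) T U ->
  exists S, [/\ positive_contractions p1 S, U S & exists u, norming S u].
Proof.
move=> PT TU; have [T0 T1] := PT.
have /choice[S HS] n : exists S, (positive_contractions p1 S /\ exists u, norming S u) /\
  (forall j, (j < n.+1)%N -> N (S (ellp_basis p1 j) - T (ellp_basis p1 j)) <=
     2 * n.+1%:R^-1 + N (ellp_tail n.+1 (T (ellp_basis p1 j)))) /\
  (forall k x, (k < n.+1)%N -> modc ((S x - T x) k) <=
     n.+1%:R^-1 * N x + modc (T (ellp_tail n.+1 x) k)).
  by have [S ? ?] := exists_norming_approximation n PT; exists S.
have small (e : R) : 0 < e -> \forall n \near \oo, n.+1%:R^-1 < e.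
  by move=> e0; have := @near_infty_natSinv_lt R (PosNum e0).
have : S @ \oo --> (T : Topological.Pack (SOTs X)).
  apply: cvg_SOTs_of_rows_columns => //.
  - change (\forall n \near \oo, `|S n| <= 1).
    by apply: nearW => n; have [[[]]] := HS n.
  - move=> j e e0.
    have e4 : 0 < e / 4 by rewrite divr_gt0.
    have [M hM] := tail_small (T (ellp_basis p1 j)) e4.
    change (\forall n \near \oo,
      N (S n (ellp_basis p1 j) - T (ellp_basis p1 j)) < e).
    near=> n.
    have [_ [+ _]] := HS n => /(_ j) h.
    apply: le_lt_trans (h _) _; first by near: n; exists j.
    have hn : n.+1%:R^-1 < e / 4 by near: n; exact: small.
    have ht : N (ellp_tail n.+1 (T (ellp_basis p1 j))) < e / 4.
      by apply: hM; near: n; exists M => // n /= Mn; exact: leqW.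
    move: hn ht; set q := _^-1; set t := N _ => hn ht.
    lra.
  - move=> k e e0.
    have e2 : 0 < e / 2 by rewrite divr_gt0.
    have [M hM] := dual_tail_small p_gt1 (adjoint T (ellp_coord p1 k)) e2.
    change (\forall n \near \oo, forall x,
      modc ((S n x - T x) k) <= e * N x).
    near=> n => x.
    have [_ [_]] := HS n => /(_ k x) h.
    apply: le_trans (h _) _; first by near: n; exists k.
    have hn : n.+1%:R^-1 < e / 2 by near: n; exact: small.
    have Mn : (M <= n.+1)%N by near: n; exists M => // n /= Mn; exact: leqW.
    have := hM _ Mn x; have := ler_wpM2r (ellp_norm_ge0 x) (ltW hn).
    rewrite (_ : adjoint T (ellp_coord p1 k) (ellp_tail n.+1 x) =
      T (ellp_tail n.+1 x) k)//.
    set q := _^-1; set t := modc _; set y := N x => qy ty.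
    rewrite (_ : e * y = e / 2 * y + e / 2 * y); first exact: lerD.
    by rewrite -mulrDl -splitr.
move=> /(_ _ TU) [n _ /(_ n (leqnn n)) /= USn].
by exists (S n); have [[? ?] _] := HS n.
Unshelve. all: by end_near. Qed.

End block_operators.

Theorem theorem1p4 (R : realType) (p : R) (p_gt1 : 1 < p) :
  let X : normedModType R[i] := ellp (ltW p_gt1) in
  let P1 : set (bop X X) := positive_contractions (ltW p_gt1) in
  (p < 2 ->
     similar_on P1 (WOT X) (SOT X) /\ similar_on P1 (SOTd X) (SOTs X)) /\
  (2 < p ->
     similar_on P1 (SOT X) (SOTs X) /\ similar_on P1 (WOT X) (SOTd X)).
Proof.
move=> X P1.
have similarity t1 t2 : finer (WOT X) t1 -> finer t1 t2 -> finer t2 (SOTs X) ->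
    similar_on P1 t1 t2.
  move=> w1 t12 t2s; apply: similar_on_of_continuity_points w1 t12 t2s _ => T U PT TU.
  have [S [PS US [u Su]]] := norming_dense p_gt1 PT TU.
  exists S; split => // V SV.
  exact (norming_continuity_point p_gt1 PS Su SV).
have WW : finer (WOT X) (WOT X) by [].
have ss : finer (SOTs X) (SOTs X) by [].
have wS := @WOT_le_SOT R X; have wSd := @WOT_le_SOTd R X.
have Ss := @SOT_le_SOTs R X; have Sds := @SOTd_le_SOTs R X.
by split=> _; split; apply: similarity.
Qed.
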